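(* Consider the jump-diffusion model with noisy non-synchronous observations described in the context. Assume: (a) there exist positive constants $\nu_\mu,\nu_\gamma$ with $\max_{1\le i\le p}\sup_{0\le t\le 1}|\mu_i(t)|\le \nu_\mu$ a.s. and $\max_{1\le i\le p}\sup_{0\le t\le 1}\gamma_{ii}(t)\le\nu_\gamma$ a.s.; (b) the generalized sampling time $\{\tau_j\}$ is independent of the true log-price related processes and of the noises $\epsilon_i(t_{i,k})$, and $\max_{1\le j\le n}\Delta_j\le Cn^{-1}$ a.s.; (c) there exist positive constants $\nu_Q$ and $\alpha_1,\ldots,\alpha_p>1$ such that $\max_{1\le i\le p}\mathrm{E}\{|Q^c_{ii}(\tau_k)|^{\alpha_i}\}\le\nu_Q$ for all $1\le k\le n-K_n$; (d) for $i,j=1,\ldots,p$, $\mathrm{E}[\epsilon_i(t_{i,k})\epsilon_j(t_{j,k'})]=\eta_{ij}$ if $t_{i,k}=t_{j,k'}$, $\epsilon_i(t_{i,k})$ is independent of $\epsilon_j(t_{j,k'})$ if $t_{i,k}\ne t_{j,k'}$, and $\epsilon_i(\cdot)$ is independent of the true log-price related processes; (e) the Blumenthal-Getoor index satisfies $\pi\in[0,2)$, and $I_i(|x|>n^{(1-\alpha_i)/(4\alpha_i-2\alpha_i\pi)})<\infty$ (finite uniformly in $n$) for $i=1,\ldots,p$. Let $\delta^{-1}\in[n^{c},e^{n^{1/2}}]$ for some positive constant $c>0$, and let $\alpha_{ij}\in(1,2)$ for some $1\le i,j\le p$. Then, for a sufficiently large $n$, $$\min_{\hat T_{ij}(Q_{ij}(\tau_k),\delta)}\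 \max_{Q^c\in\Xi(\alpha_1,\ldots,\alpha_p)}\Pr\left\{|\hat T_{ij}(Q_{ij}(\tau_k),\delta)-T_{ij}|\ge C\left(n^{-1/2}\log\delta^{-1}\right)^{(\alpha_{ij}-1)/\alpha_{ij}}\right\}\ge\delta,$$ where $$\Xi(\alpha_1,\ldots,\alpha_p)=\Big\{Q^c=(Q^c_{ii}(\tau_k))_{i=1,\ldots,p,\,k=1,\ldots,n-K_n}:\ \max_{i,k}\mathrm{E}\{|Q^c_{ii}(\tau_k)|^{\alpha_i}\}\le C\Big\}.$$
   Context: $C$ denotes a generic positive constant whose value is free of $n$ and $p$ and may vary between appearances. Model. On a filtered probability space $(\Omega,\mathcal F,\{\mathcal F_t\}_{t\in[0,1]},P)$ satisfying the usual conditions, the true log-prices $X(t)=(X_1(t),\ldots,X_p(t))^\top$ satisfy $dX(t)=dX^c(t)+dJ(t)$, $dX^c(t)=\mu(t)dt+\sigma^\top(t)dW_t$, $X^c(0)=X(0)$, where $\mu(t)$ is a $p$-dimensional drift, $\sigma(t)$ is $q\times p$, and $W_t$ is a $q$-dimensional Brownian motion with independent components. The jump process is $J_i(t)=J_{i1}(t)+J_{i2}(t)$, with $J_{i1}(t)=\int_0^t\int_{|x|>1}x\,N_i(dx,ds)$ and $J_{i2}(t)=\int_0^t\int_{|x|\le1}x\,[N_i(dx,ds)-I_i(dx)ds]$, where $N_i$ is a Poisson random measure on $\mathbb R\times[0,1]$ with intensity measure $I_i(dx)ds$; $J_{i1}$ is a compound Poisson process with bounded intensity and $J_{i2}$ is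 an independent Lévy process. The Blumenthal-Getoor index is $\pi=\inf\{\delta\ge0:\int_{|x|\le1}|x|^\delta I_i(dx)<\infty\text{ for all }i=1,\ldots,p\}$. Put $\gamma(t)=(\gamma_{ij}(t))=\sigma^\top(t)\sigma(t)$ and $\Gamma=(\Gamma_{ij})=\int_0^1\gamma(s)ds$. Observations. $Y_i(t_{i,k})=X_i(t_{i,k})+\epsilon_i(t_{i,k})$, $i=1,\ldots,p$, $k=0,\ldots,n_i$, where for each $i$ the noises $\epsilon_i(t_{i,k})$ are i.i.d. with mean zero; $\mathrm{E}[\epsilon_i(t)\epsilon_j(t)]=\eta_{ij}$, and $\epsilon_i(t)$, $\epsilon_j(t')$ are independent for $t\neq t'$. Sampling. A generalized sampling time is $0=\tau_0<\tau_1<\cdots<\tau_n=1$ such that each asset has at least one observation between consecutive $\tau_j$'s and $\Delta_j=\tau_j-\tau_{j-1}$ satisfy $\sup_j\Delta_j\to0$ in probability. For each $i,k$ choose any $\tau_{i,k}\in(\tau_{k-1},\tau_k]\cap\{t_{i,l}:l=0,\ldots,n_i\}$. Pre-averaging. $K_n=C_Kn^{1/2}$ for a constant $C_K>0$; $g$ is continuous and piecewise continuously differentiable with piecewise Lipschitz derivative, $g(0)=g(1)=0$, $\int_0^1g(t)^2dt>0$; $\phi=\frac1{K_n}\sum_{l=0}^{K_n-1}g(l/K_n)^2$; $\zeta=\sum_{l=0}^{K_n-1}\{g(l/K_n)-g((l+1)/K_n)\}^2$. Define $Z_i(\tau_k)=\sum_{l=0}^{K_n-1}g(l/K_n)\{Y_i(\tau_{i,k+l+1})-Y_i(\tau_{i,k+l})\}$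 and $Q_{ij}(\tau_k)=\frac{n-K_n}{\phi K_n}Z_i(\tau_k)Z_j(\tau_k)$, $k=1,\ldots,n-K_n$. $Z_i^c$ and $Q^c_{ij}$ are defined in the same way with $Y_i$ replaced by $Y^c_i(\tau_{i,k})=X^c_i(\tau_{i,k})+\epsilon_i(\tau_{i,k})$. Target and estimators. $\rho_{ij}=\frac{\sum_{k=1}^n\mathbf 1(\tau_{i,k}=\tau_{j,k})}{\phi K_n}\zeta\eta_{ij}$, $T_{ij}=\Gamma_{ij}+\rho_{ij}$, and $\alpha_{ij}=2\wedge\frac{2\alpha_i\alpha_j}{\alpha_i+\alpha_j}$. The minimum is over all pre-averaging estimators $\hat T_{ij}(Q_{ij}(\tau_k),\delta)=\hat T_{ij}(Q_{ij}(\tau_1),\ldots,Q_{ij}(\tau_{n-K_n}),\delta)$ of $T_{ij}$, i.e. functions of the pre-averaged variables $Q_{ij}(\tau_1),\ldots,Q_{ij}(\tau_{n-K_n})$ and possibly of $\delta$. The maximum is over the data-generating models consisting of a jump-diffusion log-price process $dX(t)=\mu(t)dt+\sigma^\top(t)dW_t+dJ(t)$ observed with noise as $Y_i(t_{i,k})=X_i(t_{i,k})+\epsilon_i(t_{i,k})$ and sampled at the times $\tau_{i,k}$, whose variables $Q^c_{ii}(\tau_k)$ belong to $\Xi(\alpha_1,\ldots,\alpha_p)$; $T_{ij}$, the law of $Q_{ij}(\tau_k)$ and $\Pr$ are those of the model. *)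

(* Defs.v *)
From HB Require Import structures.
From mathcomp Require Export all_boot all_order all_algebra.
From mathcomp Require Export all_classical all_reals all_analysis.
(* for the sigma-algebra on \bar R, which all_analysis does not export *)
From mathcomp Require Export measurable_realfun.

Set Implicit Arguments.
Unset Strict Implicit.
Unset Printing Implicit Defensive.

Import Order.TTheory GRing.Theory Num.Theory.
Import numFieldNormedType.Exports.

Local Open Scope classical_set_scope.
Local Open Scope ring_scope.

Section Stochastic.
Context {R : realType} {d : measure_display} {Om : measurableType d}.
Variables (P : probability Om R) (F : R -> set (set Om)).

Definition sigma_gen (V : set (Om -> \bar R)) : set (set Om) :=
  <<s [set E | exists2 Z, V Z &
         exists2 B : set (\bar R), measurable B & E = Z @^-1` B] >>.

Definition indep_sigma (G H : set (set Om)) : Prop :=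
  forall A B, G A -> H B -> P (A `&` B) = (P A * P B)%E.

(* Convergence to 0 in probability of nonnegative variables along a filter. *)
Definition cvg_prob0 (U : Type) (L : set_system U) (Z : U -> Om -> \bar R) :=
  forall e : R, 0 < e ->
    (fun u => P [set w | (e%:E < Z u w)%E]) @ L --> 0%E.

(* The inclusion of the negligible sets in F 0 also makes P complete. *)
Definition usual_conditions : Prop :=
  [/\ forall t, 0 <= t <= 1 -> sigma_algebra setT (F t) /\ F t `<=` measurable,
      forall s t, 0 <= s -> s <= t -> t <= 1 -> F s `<=` F t,
      forall t, 0 <= t < 1 ->
        [set A | forall u, t < u <= 1 -> F u A] `<=` F t
    & [set A | P.-negligible A] `<=` F 0].

Definition adapted (Z : R -> Om -> R) : Prop :=
  forall t B, 0 <= t <= 1 -> measurable B -> F t (Z t @^-1` B).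

Definition progressive (Z : R -> Om -> R) : Prop :=
  forall t B, 0 <= t <= 1 -> measurable B ->
    <<s [set E : set (R * Om) |
         exists A D, [/\ measurable A, F t D & E = A `*` D]] >>
      [set z | 0 <= z.1 <= t /\ B (Z z.1 z.2)].

Definition as_continuous (Z : R -> Om -> R) : Prop :=
  {ae P, forall w, {within `[0, 1], continuous (fun t => Z t w)}}.

Definition as_cadlag (Z : R -> Om -> R) : Prop :=
  {ae P, forall w,
    (forall t, 0 <= t < 1 -> Z s w @[s --> t^'+] --> Z t w) /\
    (forall t, 0 < t <= 1 -> cvg (Z s w @[s --> t^'-]))}.

(* F-Brownian motion with independent components: given F s, the increments
   W l t - W l s are jointly independent N(0, t - s). *)
Definition brownian (q : nat) (W : 'I_q -> R -> Om -> R) : Prop :=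
  [/\ forall l, adapted (W l) /\ as_continuous (W l),
      forall l, {ae P, forall w, W l 0 w = 0}
    & forall s t A (B : 'I_q -> set R),
        0 <= s -> s < t -> t <= 1 -> F s A -> (forall l, measurable (B l)) ->
        P [set w | A w /\ forall l, B l (W l t w - W l s w)] =
        (P A * \prod_(l < q) normal_prob 0%R (Num.sqrt (t - s)%R) (B l))%E].

Record simple_integrand (q : nat) := SimpleIntegrand {
  si_size : nat;
  si_time : nat -> R;
  si_coef : 'I_q -> nat -> Om -> R }.

Definition simple_ok (q : nat) (H : simple_integrand q) : Prop :=
  [/\ forall k, (k < si_size H)%N ->
        0 <= si_time H k /\ si_time H k < si_time H k.+1 <= 1,
      exists M, forall l k w, `|si_coef H l k w| <= M
    & forall l k B, (k < si_size H)%N -> measurable B ->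
        F (si_time H k) (si_coef H l k @^-1` B)].

Definition simple_val (q : nat) (H : simple_integrand q) l t w : R :=
  \sum_(k < si_size H)
    si_coef H l k w * (si_time H k < t <= si_time H k.+1)%R%:R.

Definition simple_int (q : nat) (W : 'I_q -> R -> Om -> R)
    (H : simple_integrand q) t w : R :=
  \sum_(l < q) \sum_(k < si_size H) si_coef H l k w *
    (W l (Num.min (si_time H k.+1) t) w - W l (Num.min (si_time H k) t) w).

(* M t = \sum_l \int_0^t S l s dW_l(s): the Ito integral, as the continuous
   adapted process that is the limit in probability of integrals of simple
   integrands H m with \int_0^1 |H m - S|^2 ds -> 0 in probability.  For
   progressive S this determines M up to indistinguishability, and does not
   depend on the approximating sequence. *)
Definition is_ito_integral (q : nat) (W S : 'I_q -> R -> Om -> R)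
    (M : R -> Om -> R) : Prop :=
  [/\ adapted M, as_continuous M
    & exists H : nat -> simple_integrand q,
      [/\ forall m, simple_ok (H m),
          cvg_prob0 \oo (fun m w => \int[lebesgue_measure]_(s in `[0%R, 1%R])
            (\sum_(l < q) (simple_val (H m) l s w - S l s w) ^+ 2)%:E)%E
        & forall t, 0 <= t <= 1 -> cvg_prob0 \oo (fun m w =>
            (`|simple_int W (H m) t w - M t w|)%:E)]].

Definition levy_measure (I : {measure set R -> \bar R}) : Prop :=
  I [set 0] = 0%E /\ (\int[I]_x (Num.min 1 (x ^+ 2))%:E < +oo)%E.

Definition strip (s t : R) : set (R * R) := [set z | s <= z.2 <= t].

(* A point of R * [0, 1] is (jump size, jump time). *)
Definition jump_intensity (I : {measure set R -> \bar R})
  : set (R * R) -> \bar R := (I \x @lebesgue_measure R)%E.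

(* Poisson random measure on R * [0, 1] relative to the filtration F, with
   intensity I(dx)ds.  In the last item A = setT gives the independence over
   disjoint sets, and general A the independence of F s; points at time s
   itself are excluded, which is harmless as R * {s} has intensity 0. *)
Definition poisson_random_measure (I : {measure set R -> \bar R})
    (N : Om -> {measure set (R * R)%type -> \bar R}) : Prop :=
  [/\ forall t (B : set (R * R)) (C : set (\bar R)), 0 <= t <= 1 ->
        measurable B -> B `<=` strip 0 t -> measurable C ->
        F t [set w | C (N w B)],
      forall (B : set (R * R)) (k : nat), measurable B -> B `<=` strip 0 1 ->
        (jump_intensity I B < +oo)%E ->
        let r := fine (jump_intensity I B) in
        P [set w | N w B = (k%:R)%:E] = (expR (- r) * r ^+ k / k`!%:R)%:E,
      forall (B : set (R * R)), measurable B -> B `<=` strip 0 1 ->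
        jump_intensity I B = +oo%E -> {ae P, forall w, N w B = +oo%E}
    & forall s A m (B : 'I_m -> set (R * R)) (C : 'I_m -> set (\bar R)),
        0 <= s <= 1 -> F s A ->
        (forall j, measurable (B j) /\ B j `<=` [set z | s < z.2 <= 1]) ->
        trivIset setT B -> (forall j, measurable (C j)) ->
        P [set w | A w /\ forall j, C j (N w (B j))] =
        (P A * \prod_(j < m) P [set w | C j (N w (B j))])%E].

Definition large_jumps (N : Om -> {measure set (R * R)%type -> \bar R})
    (t : R) (w : Om) : R :=
  \int[N w]_(z in [set z | 1 < `|z.1|] `&` strip 0 t) z.1.

Definition truncated_small_jumps (I : {measure set R -> \bar R})
    (N : Om -> {measure set (R * R)%type -> \bar R}) (e t : R) (w : Om) : R :=
  (\int[N w]_(z in [set z | e < `|z.1| <= 1] `&` strip 0 t) z.1)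
  - t * \int[I]_(x in [set x | e < `|x| <= 1]) x.

(* \int_0^t\int_(|x| <= 1) x (N(dx,ds) - I(dx)ds), the compensated integral
   being the limit in probability of the integrals over e < |x| <= 1. *)
Definition is_small_jumps (I : {measure set R -> \bar R})
    (N : Om -> {measure set (R * R)%type -> \bar R}) (J : R -> Om -> R) : Prop :=
  [/\ adapted J, as_cadlag J
    & forall t, 0 <= t <= 1 -> cvg_prob0 0^'+ (fun e w =>
        (`|truncated_small_jumps I N e t w - J t w|)%:E)].

End Stochastic.

Unset Implicit Arguments.

(* All the objects of one experiment.  The indices k of tau, tobs, sel and eps
   are meaningful only for 0 <= k <= n, 0 <= k <= nobs i, 1 <= k <= n and
   0 <= k <= nobs i, respectively.  The noise eps i k is epsilon_i(t_{i,k}),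
   and tau_{i,k} is the observation time t_{i, sel i k}; mart i is the Ito
   integral of the i-th component, and J2 i the compensated small jumps. *)
Record model (R : realType) (p q : nat) := Model {
  disp : measure_display;
  Om : measurableType disp;
  Pr : probability Om R;
  filt : R -> set (set Om);
  W : 'I_q -> R -> Om -> R;
  X0 : 'I_p -> Om -> R;
  mu : 'I_p -> R -> Om -> R;
  sigma : R -> Om -> 'M[R]_(q, p);
  mart : 'I_p -> R -> Om -> R;
  levy : 'I_p -> {measure set R -> \bar R};
  N : 'I_p -> Om -> {measure set (R * R)%type -> \bar R};
  J2 : 'I_p -> R -> Om -> R;
  tau : nat -> Om -> R;
  nobs : 'I_p -> nat;
  tobs : 'I_p -> nat -> Om -> R;
  sel : 'I_p -> nat -> Om -> nat;
  eps : 'I_p -> nat -> Om -> R;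
  eta : 'M[R]_p }.

Arguments disp {R p q} m.
Arguments Om {R p q} m.
Arguments Pr {R p q} m.
Arguments filt {R p q} m.
Arguments W {R p q} m.
Arguments X0 {R p q} m.
Arguments mu {R p q} m.
Arguments sigma {R p q} m.
Arguments mart {R p q} m.
Arguments levy {R p q} m.
Arguments N {R p q} m.
Arguments J2 {R p q} m.
Arguments tau {R p q} m.
Arguments nobs {R p q} m.
Arguments tobs {R p q} m.
Arguments sel {R p q} m.
Arguments eps {R p q} m.
Arguments eta {R p q} m.

Section Model.
Context {R : realType} {p q : nat}.
Variable m : model R p q.
Implicit Types (i j : 'I_p).

Definition Xc i (t : R) (w : Om m) : R :=
  X0 m i w + (\int[lebesgue_measure]_(s in `[0, t]) mu m i s w) + mart m i t w.
Definition J1 i (t : R) (w : Om m) : R := large_jumps (N m i) t w.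
Definition J i (t : R) (w : Om m) : R := J1 i t w + J2 m i t w.
Definition X i (t : R) (w : Om m) : R := Xc i t w + J i t w.

Definition gam (t : R) (w : Om m) : 'M[R]_p :=
  (sigma m t w)^T *m sigma m t w.
Definition Gam i j (w : Om m) : R :=
  \int[lebesgue_measure]_(s in `[0, 1]) gam s w i j.

Definition blumenthal_getoor_index : R :=
  inf [set x : R | 0 <= x /\ forall i,
    (\int[levy m i]_(y in `[(-1)%R, 1%R]) (`|y| `^ x)%:E < +oo)%E].

Definition jump_diffusion : Prop :=
  [/\ usual_conditions (Pr m) (filt m) /\ brownian (Pr m) (filt m) (W m),
      forall i B, measurable B -> filt m 0 (X0 m i @^-1` B),
      forall i, progressive (filt m) (mu m i) /\
        {ae Pr m, forall w, lebesgue_measure.-integrable `[0, 1]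
                              (fun s => (mu m i s w)%:E)},
      forall i, (forall l, progressive (filt m) (fun t w => sigma m t w l i)) /\
        is_ito_integral (Pr m) (filt m) (W m)
          (fun l t w => sigma m t w l i) (mart m i)
    & forall i, [/\ levy_measure (levy m i),
        poisson_random_measure (Pr m) (filt m) (levy m i) (N m i)
      & is_small_jumps (Pr m) (filt m) (levy m i) (N m i) (J2 m i)]].

(* The variables making up the "true log-price related processes", of which
   the sampling and the noise are independent. *)
Definition price_vars : set (Om m -> \bar R) :=
  [set Z |
   (exists i t, 0 <= t <= 1 /\
     ([\/ Z = EFin \o X i t, Z = EFin \o Xc i t, Z = EFin \o J1 i t |
          Z = EFin \o J2 m i t] \/ Z = EFin \o mu m i t)) \/
   (exists l i t, 0 <= t <= 1 /\
     (Z = EFin \o W m l t \/ Z = (fun w => (sigma m t w l i)%:E))) \/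
   (exists i (B : set (R * R)), measurable B /\ B `<=` strip 0 1 /\
     Z = (fun w => N m i w B))].
Definition noise_vars i : set (Om m -> \bar R) :=
  [set Z | exists2 k, (k <= nobs m i)%N & Z = EFin \o eps m i k].
Definition sampling_vars (n : nat) : set (Om m -> \bar R) :=
  [set Z | (exists2 k, (k <= n)%N & Z = EFin \o tau m k) \/
   (exists i k, (k <= nobs m i)%N /\ Z = EFin \o tobs m i k) \/
   (exists i k, (0 < k <= n)%N /\ Z = (fun w => ((sel m i k w)%:R)%:E))].

(* tau_{i,k} *)
Definition tausel i (k : nat) (w : Om m) : R := tobs m i (sel m i k w) w.

Definition sampling_scheme (n : nat) : Prop :=
  [/\ forall Z, sampling_vars n Z -> measurable_fun setT Z,
      forall w, [/\ tau m 0 w = 0, tau m n w = 1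
        & forall k, (k < n)%N -> tau m k w < tau m k.+1 w],
      forall i w k, (k <= nobs m i)%N -> 0 <= tobs m i k w <= 1,
      forall i w k, (k < nobs m i)%N -> tobs m i k w < tobs m i k.+1 w
    & forall i w k, (0 < k <= n)%N ->
        (sel m i k w <= nobs m i)%N /\
        tau m k.-1 w < tausel i k w <= tau m k w].

Definition iid_noise : Prop :=
  forall i,
  [/\ forall k, (k <= nobs m i)%N ->
        (Pr m).-integrable setT (EFin \o eps m i k) /\
        ('E_(Pr m)[eps m i k] = 0)%E,
      forall k B, (k <= nobs m i)%N -> measurable B ->
        Pr m (eps m i k @^-1` B) = Pr m (eps m i 0 @^-1` B)
    & forall B : nat -> set R, (forall k, measurable (B k)) ->
        Pr m [set w | forall k, (k <= nobs m i)%N -> B k (eps m i k w)] =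
        (\prod_(k < (nobs m i).+1) Pr m (eps m i k @^-1` B k))%E].

Definition observed_jump_diffusion (n : nat) : Prop :=
  [/\ jump_diffusion, sampling_scheme n & iid_noise].

(* Y_i(tau_{i,k}) and Y^c_i(tau_{i,k}) *)
Definition Y i (k : nat) (w : Om m) : R :=
  X i (tausel i k w) w + eps m i (sel m i k w) w.
Definition Yc i (k : nat) (w : Om m) : R :=
  Xc i (tausel i k w) w + eps m i (sel m i k w) w.

End Model.

Arguments blumenthal_getoor_index {R p q} m.

(* On each open piece g' is Lipschitz, hence continuous with one-sided limits
   at the end points. *)
Definition weight_function {R : realType} (g : R -> R) : Prop :=
  [/\ {within `[0, 1], continuous g}, g 0 = 0, g 1 = 0,
      0 < \int[lebesgue_measure]_(t in `[0, 1]) g t ^+ 2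
    & exists (r : nat) (s : nat -> R), [/\ s 0 = 0, s r = 1
      & forall k, (k < r)%N -> [/\ s k < s k.+1,
          forall x, s k < x < s k.+1 -> derivable g x 1
        & [lipschitz derive1 g x | x in `]s k, s k.+1[]]]].

(* K_n = C_K n^(1/2), rounded down to an integer. *)
Definition window {R : realType} (C_K : R) (n : nat) : nat :=
  Num.truncn (C_K * Num.sqrt n%:R).

Definition phi {R : realType} (g : R -> R) (K : nat) : R :=
  K%:R^-1 * \sum_(l < K) g (l%:R / K%:R) ^+ 2.
Definition zeta {R : realType} (g : R -> R) (K : nat) : R :=
  \sum_(l < K) (g (l%:R / K%:R) - g (l.+1%:R / K%:R)) ^+ 2.

Section PreAveraging.
Context {R : realType} {p q : nat}.
Variables (g : R -> R) (K n : nat) (m : model R p q).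
Implicit Types (i j : 'I_p) (k : nat) (alpha : 'I_p -> R).

Definition preavg (y : nat -> Om m -> R) k (w : Om m) : R :=
  \sum_(l < K) g (l%:R / K%:R) * (y (k + l).+1 w - y (k + l)%N w).

(* Q_ij(tau_k) and Q^c_ij(tau_k), for 1 <= k <= n - K *)
Definition Q i j k (w : Om m) : R :=
  (n - K)%N%:R / (phi g K * K%:R) *
  preavg (Y m i) k w * preavg (Y m j) k w.
Definition Qc i j k (w : Om m) : R :=
  (n - K)%N%:R / (phi g K * K%:R) *
  preavg (Yc m i) k w * preavg (Yc m j) k w.

(* (Q_ij(tau_1), ..., Q_ij(tau_{n-K})) *)
Definition Qvec i j (w : Om m) : (n - K).-tuple R :=
  [tuple Q i j k.+1 w | k < n - K].

Definition rho i j (w : Om m) : R :=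
  (\sum_(1 <= k < n.+1) (tausel m i k w == tausel m j k w)%:R) /
  (phi g K * K%:R) * zeta g K * eta m i j.
Definition target i j (w : Om m) : R := Gam m i j w + rho i j w.

Definition bounded_coefficients (nu_mu nu_gamma : R) : Prop :=
  {ae Pr m, forall w, forall i t, 0 <= t <= 1 -> `|mu m i t w| <= nu_mu} /\
  {ae Pr m, forall w, forall i t, 0 <= t <= 1 -> gam m t w i i <= nu_gamma}.

(* Independence from the noises is stated asset by asset: with random
   observation times, the joint law of the noises of two assets depends on
   which of their times coincide.  It is specified conditionally on the
   sampling in noise_condition. *)
Definition sampling_condition (C_tau : R) : Prop :=
  (forall i, indep_sigma (Pr m) (sigma_gen (sampling_vars m n))
               (sigma_gen (price_vars m `|` noise_vars m i))) /\
  {ae Pr m, forall w, forall k, (k < n)%N ->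
     tau m k.+1 w - tau m k w <= C_tau / n%:R}.

(* max_(i,k) E|Q^c_ii(tau_k)|^(alpha_i) <= C; for fixed C this is membership
   in Xi(alpha_1, ..., alpha_p). *)
Definition Qc_moments (C : R) alpha : Prop :=
  forall i k, (0 < k <= n - K)%N ->
    ('E_(Pr m)[fun w => (`|Qc i i k w| `^ alpha i)%R] <= C%:E)%E.

(* A ranges over the events of the sampling sigma-algebra on which the two
   observation times agree, respectively differ; for deterministic times these
   reduce to E[eps eps'] = eta i j and to independence. *)
Definition noise_condition : Prop :=
  (forall i j k k', (k <= nobs m i)%N -> (k' <= nobs m j)%N ->
     (forall A, sigma_gen (sampling_vars m n) A ->
        A `<=` [set w | tobs m i k w = tobs m j k' w] ->
        (\int[Pr m]_(w in A) (eps m i k w * eps m j k' w)%:E =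
         (eta m i j)%:E * Pr m A)%E) /\
     (forall A, sigma_gen (sampling_vars m n) A ->
        A `<=` [set w | tobs m i k w != tobs m j k' w] ->
        forall B B', measurable B -> measurable B' ->
        Pr m (A `&` (eps m i k @^-1` B) `&` (eps m j k' @^-1` B')) =
        (Pr m A * Pr m (eps m i k @^-1` B) * Pr m (eps m j k' @^-1` B'))%E)) /\
  indep_sigma (Pr m) (sigma_gen (\bigcup_i noise_vars m i))
                     (sigma_gen (price_vars m)).

(* As the model may change with n, finiteness uniform in n is a bound by a
   constant nu_I. *)
Definition jump_condition (nu_I : R) alpha : Prop :=
  let pi := blumenthal_getoor_index m in
  0 <= pi < 2 /\
  forall i,
    let r := n%:R `^ ((1 - alpha i) /
                      (4 * alpha i - 2 * alpha i * pi)) in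
    (levy m i [set x | (r < `|x|)%R] <= nu_I%:E)%E.

Definition assumptions (nu_mu nu_gamma C_tau nu_Q nu_I : R) alpha : Prop :=
  [/\ bounded_coefficients nu_mu nu_gamma, sampling_condition C_tau,
      Qc_moments nu_Q alpha, noise_condition & jump_condition nu_I alpha].

End PreAveraging.

(* Main.v *)
Require Import Defs.
From HB Require Import structures.
From mathcomp Require Import ring lra.
Import Order.TTheory GRing.Theory Num.Theory.
Import numFieldNormedType.Exports.
Local Open Scope classical_set_scope.
Local Open Scope ring_scope.

Set Implicit Arguments.
Unset Strict Implicit.
Unset Printing Implicit Defensive.

(** The bound is a two-point argument in which the observations carry no price
    at all. Let all log-prices be constantly 0, observe every asset at the times
    k / n, and let the noise of asset l at time k / n be M_l S_k, where the S_k
    are i.i.d. signs, equal to 0 with probability 1 - e and to 1 or -1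
    with probability e / 2 each. With all amplitudes M_l equal to 0, every Q
    vanishes and so does the target. With positive amplitudes the target is
    rho_ij = n zeta M_i M_j e / (phi K), a constant; but with probability
    (1 - e) ^ (n + 1) all signs vanish, and then every Q is 0 again. The
    estimator thus has to answer two targets on the basis of the same zero
    vector, and misses one of them by rho_ij / 2 (two_point). For
    e = c_1 ln (1 / delta) / n with c_1 small, (1 - e) ^ (n + 1) >= delta
    (quiet_probability).

    It remains to choose the amplitudes as large as the moment condition
    allows. If N is the number of nonzero signs in a window, summation by parts
    and the Lipschitz property of g give Q_ll <= B_l N ^ 2 with B_l
    proportional to M_l ^ 2, while the moment of N of order 2 alpha_l is of the
    order of x = K e, the probability of seeing any sign at all
    (pure_noise_moment). So B_l may be of order x ^ (- 1 / alpha_l)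
    (amplitude_moment_bound), and rho_ij is then at least of order
    x ^ (1 - 1 / (2 alpha_i) - 1 / (2 alpha_j)) = x ^ ((alpha_ij - 1) / alpha_ij)
    (amplitude_bias). As K is of order n ^ (1/2), x is of order
    n ^ (- 1/2) ln (1 / delta), which is the announced rate.

    A model must also contain a Brownian motion, for a filtration that
    satisfies the usual conditions, independent of the noise. It is borrowed
    from the model whose existence is assumed: the new models live on the
    product of its probability space with the finite space of sign
    sequences, where the conditions can be checked fiber by fiber
    (finext_usual_conditions, finext_brownian, finext_indep). *)

(** * Product of a probability space with a finite one *)

(** Strict positivity makes the empty set the only negligible subset of a finite
    factor, so that adjoining it to a complete space creates no null sets
    beyond those that are null in every fiber. *)
Record weights (R : realType) (D : finType) := Weights {
  wt :> D -> R;
  wt_gt0 : forall x, 0 < wt x;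
  wt_sum1 : \sum_x wt x = 1 }.

(** The second factor will carry the noise; the parameter x0 makes the product
    a pointed type. *)
Definition finext (T : Type) (D : finType) (x0 : D) : Type := (T * D)%type.
Definition fiber (T : Type) (D : finType) (x0 : D) (x : D) (w : T)
  : finext T x0 := (w, x).
Arguments fiber {T D x0} x w.

Section FiniteExtension.
Context {d : measure_display} {T : measurableType d} {D : finType} {x0 : D}.

HB.instance Definition _ := Choice.copy (finext T x0) (T * D)%type.
HB.instance Definition _ := isPointed.Build (finext T x0) (point, x0).

(** The product with a finite discrete factor, described by its fibers: this
    turns every question about the product, completeness included, into
    finitely many questions about T. *)
Definition fin_measurable : set (set (finext T x0)) :=
  [set A | forall x, measurable (fiber x @^-1` A)].

Let fin_measurable0 : fin_measurable set0.
Proof. by move=> x; rewrite preimage_set0. Qed.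

Let fin_measurableC A : fin_measurable A -> fin_measurable (~` A).
Proof. by move=> mA x; rewrite -preimage_setC; apply: measurableC; exact: mA. Qed.

Let fin_measurable_bigcup (F : (set (finext T x0))^nat) :
  (forall i, fin_measurable (F i)) -> fin_measurable (\bigcup_i (F i)).
Proof.
by move=> mF x; rewrite preimage_bigcup; apply: bigcup_measurable => i _; exact: mF.
Qed.

HB.instance Definition _ := isMeasurable.Build d (finext T x0)
  fin_measurable0 fin_measurableC fin_measurable_bigcup.

Lemma finext_measurableP (A : set (finext T x0)) :
  measurable A <-> forall x, measurable (fiber x @^-1` A).
Proof. by []. Qed.

Context {R : realType} (P : probability T R) (p : weights R D).

Definition finext_prob (A : set (finext T x0)) : \bar R :=
  (\sum_x (p x)%:E * P (fiber x @^-1` A))%E.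

Let finext_prob0 : finext_prob set0 = 0%E.
Proof.
by rewrite /finext_prob big1// => x _; rewrite preimage_set0 measure0 mule0.
Qed.

Let finext_prob_ge0 A : (0 <= finext_prob A)%E.
Proof.
by apply: sume_ge0 => x _; rewrite mule_ge0// lee_fin ltW// wt_gt0.
Qed.

Let finext_prob_sigma : semi_sigma_additive finext_prob.
Proof.
move=> F mF tF mUF.
rewrite [X in X @ _ --> _](_ : _ = fun n =>
    (\sum_x (p x)%:E * \sum_(0 <= i < n) P (fiber x @^-1` F i))%E); last first.
  apply/funext => n; rewrite exchange_big/=; apply: eq_bigr => x _.
  by rewrite ge0_sume_distrr.
apply: cvg_nnesum => x _.
  by near=> n; rewrite mule_ge0 ?sume_ge0// lee_fin ltW// wt_gt0.
apply: cvgeZl => //; rewrite preimage_bigcup.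
apply: (@measure_semi_sigma_additive _ _ _ P (fun i => fiber x @^-1` F i)).
- by move=> i; exact: mF.
- apply/trivIsetP => i j _ _ ij; rewrite -preimage_setI.
  by move/trivIsetP : tF => /(_ i j I I ij) ->; rewrite preimage_set0.
- by apply: bigcup_measurable => i _; exact: mF.
Unshelve. all: by end_near. Qed.

HB.instance Definition _ := isMeasure.Build _ _ _ finext_prob
  finext_prob0 finext_prob_ge0 finext_prob_sigma.

Let finext_prob_setT : finext_prob setT = 1%E.
Proof.
rewrite /finext_prob; under eq_bigr => x _
  do rewrite preimage_setT probability_setT mule1.
by rewrite sumEFin wt_sum1.
Qed.

HB.instance Definition _ :=
  Measure_isProbability.Build _ _ _ finext_prob finext_prob_setT.

Lemma finext_prob_ge x (A : set (finext T x0)) :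
  ((p x)%:E * P (fiber x @^-1` A) <= finext_prob A)%E.
Proof.
rewrite /finext_prob (bigD1 x)//= leeDl// sume_ge0// => y _.
by rewrite mule_ge0// lee_fin ltW// wt_gt0.
Qed.

(** A sum of nonnegative terms with positive weights vanishes only if every
    term does. *)
Lemma finext_negligible (A : set (finext T x0)) :
  (finext_prob.-negligible A) <-> forall x, P.-negligible (fiber x @^-1` A).
Proof.
split=> [[B [mB PB AB]] x|nA].
  exists (fiber x @^-1` B); split; [exact: mB| |exact: preimage_subset].
  have := finext_prob_ge x B; rewrite -/finext_prob PB => PBx.
  have : ((p x)%:E * P (fiber x @^-1` B) == 0)%E.
    by rewrite eq_le PBx mule_ge0// lee_fin ltW// wt_gt0.
  by rewrite mule_eq0 eqe gt_eqF ?wt_gt0//= => /eqP.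
have /choice[B HB] x : exists B, [/\ measurable B, P B = 0%E &
    fiber x @^-1` A `<=` B] by exact: nA.
exists [set w | B w.2 w.1]; split.
- by move=> x; have [+ _ _] := HB x; exact.
- rewrite /finext_prob big1// => x _.
  by have [_ + _] := HB x => /= ->; rewrite mule0.
- by move=> [w x] Awx; have [_ _] := HB x; exact.
Qed.

Lemma finext_ae (E : set T) : {ae P, forall w, E w} ->
  {ae finext_prob, forall w, E w.1}.
Proof. by move=> nE; apply/finext_negligible => x. Qed.

Lemma finext_prob_snd (E : set D) :
  finext_prob [set w | E w.2] = (\sum_x p x * (x \in E)%:R)%:E.
Proof.
rewrite /finext_prob -sumEFin; apply: eq_bigr => x _; rewrite EFinM; congr *%E.
have [xE|xE] := boolP (x \in E).
  rewrite (_ : _ @^-1` _ = setT) ?probability_setT//.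
  by apply/seteqP; split=> // w _; rewrite /= -inE.
rewrite (_ : _ @^-1` _ = set0) ?measure0//.
by apply/seteqP; split=> // w /= Ex; rewrite mem_set in xE.
Qed.

Lemma finext_measurable_snd (E : set D) :
  measurable ([set w | E w.2] : set (finext T x0)).
Proof.
move=> x; rewrite [X in measurable X](_ : _ = [set _ | E x])//.
have [h|h] := pselect (E x).
  by rewrite (_ : [set _ | _] = setT)//; apply/seteqP; split.
by rewrite (_ : [set _ | _] = set0)//; apply/seteqP; split.
Qed.

Let finext_sum_indic (h : D -> R) : (fun w : finext T x0 => (h w.2)%:E) =
  (fun w => \sum_x ((h x)%:E * (\1_[set w : finext T x0 | w.2 = x] w)%:E))%E.
Proof.
apply/funext => -[w y]/=; rewrite (bigD1 y)//= big1 ?adde0.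
  by rewrite indicE mem_set// mule1.
move=> x xy; rewrite indicE memNset ?mule0// => /= yx.
by rewrite yx eqxx in xy.
Qed.

Let finext_indic_integrable x : finext_prob.-integrable setT
  (fun w => (\1_[set w : finext T x0 | w.2 = x] w)%:E).
Proof. by apply: integrable_indic => //; exact: (finext_measurable_snd [set x]). Qed.

Lemma finext_integrable_snd (h : D -> R) :
  finext_prob.-integrable setT (fun w => (h w.2)%:E).
Proof.
rewrite finext_sum_indic; apply: integrable_sum => // x _.
exact: integrableZl.
Qed.

Lemma finext_integral_snd (h : D -> R) :
  (\int[finext_prob]_w (h w.2)%:E = (\sum_x p x * h x)%:E)%E.
Proof.
rewrite finext_sum_indic integral_sum//=; last first.
  by move=> x; exact: integrableZl.
rewrite -sumEFin; apply: eq_bigr => x _; rewrite integralZl//.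
have mx : measurable [set w : finext T x0 | w.2 = x].
  exact: (finext_measurable_snd [set x]).
rewrite integral_indic// setIT muleC EFinM; congr *%E.
transitivity (finext_prob [set w | [set x] w.2]); first by [].
rewrite finext_prob_snd; congr EFin; rewrite (bigD1 x)//= big1 ?addr0.
  by rewrite mem_set// mulr1.
move=> y yx; rewrite memNset ?mulr0// => /= xy.
by rewrite xy eqxx in yx.
Qed.

End FiniteExtension.

(** * Filtration and Brownian motion on the product *)

Section Filtration.
Context {d : measure_display} {T : measurableType d} {D : finType} {x0 : D}.
Context {R : realType} (P : probability T R) (p : weights R D).
Variable F : R -> set (set T).

(** The filtration F enlarged just enough to contain the null sets of the
    product: an event must live on T up to a null set. Asking this of the fibers
    among themselves, rather than for a common event of F t, makes right
    continuity immediate. The finite factor stays independent of the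
    enlarged filtration. *)
Definition finext_filt (t : R) : set (set (finext T x0)) :=
  [set A | (forall x, F t (fiber x @^-1` A)) /\
     forall x y, P.-negligible (fiber x @^-1` A `\` fiber y @^-1` A)].

Local Notation P' := (@finext_prob _ _ _ x0 _ P p).
Local Notation F' := finext_filt.

Lemma finext_filt_adapted t (A : set T) : F t A -> F' t [set w | A w.1].
Proof.
move=> FA; split=> [x|x y]; first exact: FA.
rewrite setDE (_ : _ `&` _ = set0); first exact: negligible_set0.
by apply/seteqP; split=> w // -[].
Qed.

Lemma finext_fiber_prob t (A : set (finext T x0)) x y :
  usual_conditions P F -> 0 <= t <= 1 -> F' t A ->
  P (fiber x @^-1` A) = P (fiber y @^-1` A).
Proof.
move=> [sF _ _ _] t01 [FA nA]; have [_ mF] := sF t t01.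
have mA z : measurable (fiber z @^-1` A) by exact: mF.
have le u v : (P (fiber u @^-1` A) <= P (fiber v @^-1` A))%E.
  rewrite (@measureDI _ _ _ P _ _ (mA u) (mA v)).
  rewrite (@measure_negligible _ _ _ P (_ `\` _)) ?add0e//.
  - by apply: le_measure; rewrite ?inE//; exact: measurableI.
  - exact: measurableD.
by apply/eqP; rewrite eq_le !le.
Qed.

(** The fibers of an event of the filtration all have the same probability,
    which therefore factors out of the sum over the finite factor. *)
Lemma finext_indep t (A : set (finext T x0)) (E : set D) :
  usual_conditions P F -> 0 <= t <= 1 -> F' t A ->
  P' (A `&` [set w | E w.2]) = (P' A * P' [set w | E w.2])%E.
Proof.
move=> uF t01 FA; rewrite finext_prob_snd.
have PA x : P (fiber x @^-1` A) = P (fiber x0 @^-1` A)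
  by exact: (finext_fiber_prob x x0 uF t01 FA).
have fPA : P (fiber x0 @^-1` A) \is a fin_num.
  apply: fin_num_measure; have [sF _ _ _] := uF.
  by have [_] := sF t t01; apply; have [] := FA.
have P'A : P' A = P (fiber x0 @^-1` A).
  rewrite /finext_prob; under eq_bigr => x _ do rewrite PA.
  by rewrite -(fineK fPA) -ge0_sume_distrl ?sumEFin ?wt_sum1 ?mul1e//
    => x _; rewrite lee_fin ltW// wt_gt0.
rewrite P'A /finext_prob -(fineK fPA) -EFinM mulr_sumr -sumEFin.
apply: eq_bigr => x _; have [xE|xE] := boolP (x \in E).
  rewrite preimage_setI (_ : _ @^-1` [set w | E w.2] = setT); last first.
    by apply/seteqP; split=> // w _; rewrite /= -inE.
  by rewrite setIT PA mulr1 muleC -(fineK fPA) EFinM.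
rewrite preimage_setI (_ : _ @^-1` [set w | E w.2] = set0); last first.
  by apply/seteqP; split=> // w /= Ex; rewrite mem_set in xE.
by rewrite setI0 measure0 mule0 !mulr0.
Qed.

(** Completeness holds because a null set of the product has only null fibers,
    and these belong to F 0. *)
Lemma finext_usual_conditions : usual_conditions P F -> usual_conditions P' F'.
Proof.
move=> uF; have [sF mF rF nF] := uF; split.
- move=> t t01; have [[F0 FC FU] Fm] := sF t t01; split; last first.
    by move=> A [FA _]; apply/finext_measurableP => x; exact: Fm.
  split.
  + split=> [x|x y]; first by rewrite preimage_set0.
    by rewrite preimage_set0 set0D; exact: negligible_set0.
  + move=> A [FA nA]; rewrite (setTD A); split=> [x|x y].
      by have := FC _ (FA x); rewrite setTD preimage_setC.
    rewrite -!preimage_setC.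
    rewrite (setDE (~` _)) setCK setIC -setDE.
    exact: nA.
  + move=> A FA; split=> [x|x y];
      rewrite ?(preimage_bigcup (fiber x)) ?(preimage_bigcup (fiber y)).
      by apply: FU => i; have [+ _] := FA i; exact.
    apply: (@negligibleS _ _ _ _ (\bigcup_i
        (fiber x @^-1` A i `\` fiber y @^-1` A i))).
      move=> w [[i _ Ai] nAi]; exists i => //; split=> // Ay.
      by apply: nAi; exists i.
    by apply: negligible_bigcup => i; have [_] := FA i; exact.
- by move=> s t s0 st t1 A [FA nA]; split=> // x; exact: (mF s t).
- move=> t /andP[t0 t1] A FA.
  have t11 : t < 1 <= (1 : R) by rewrite t1 lexx.
  have [_ nA] := FA 1 t11; split=> // x.
  apply: rF; first by rewrite t0.
  by move=> u tu; have [+ _] := FA u tu; exact.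
- move=> A /finext_negligible nA; split=> [x|x y].
    by apply: nF; exact: nA.
  by apply: negligibleS (nA x); exact: subDsetl.
Qed.

Lemma finext_brownian q (W : 'I_q -> R -> T -> R) :
  usual_conditions P F -> brownian P F W ->
  brownian P' F' (fun l t w => W l t w.1).
Proof.
move=> uF [aW W0 indW]; split.
- move=> l; have [adW cW] := aW l; split.
    move=> t B t01 mB; apply: (@finext_filt_adapted t (W l t @^-1` B)).
    exact: adW.
  exact: finext_ae cW.
- by move=> l; exact: finext_ae (W0 l).
- move=> s t A B s0 st t1 [FA _] mB.
  rewrite /finext_prob ge0_sume_distrl; last first.
    by move=> x _; rewrite mule_ge0// lee_fin ltW// wt_gt0.
  apply: eq_bigr => x _; rewrite -muleA; congr *%E.
  exact: (indW s t (fiber x @^-1` A) B s0 st t1 (FA x) mB).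
Qed.

End Filtration.

(** * Models whose observations are pure noise *)

Section ProductWeights.
Context {R : realType} {S : finType} (p : weights R S) (n : nat).

(** The expectation of a product of functions of independent coordinates; all
    the probabilities and moments of the noise are instances of it. *)
Lemma product_expectation (h : 'I_n -> S -> R) :
  \sum_(f : {ffun 'I_n -> S}) (\prod_k p (f k)) * (\prod_k h k (f k)) =
  \prod_k \sum_s p s * h k s.
Proof.
rewrite bigA_distr_bigA; apply: eq_bigr => f _.
by rewrite big_split.
Qed.

Let prod_wt_gt0 (f : {ffun 'I_n -> S}) : 0 < \prod_k p (f k).
Proof. by apply: prodr_gt0 => k _; exact: wt_gt0. Qed.

Let prod_wt_sum1 : \sum_(f : {ffun 'I_n -> S}) \prod_k p (f k) = 1.
Proof.
rewrite -(bigA_distr_bigA (fun _ s => p s)) big1// => k _.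
exact: wt_sum1.
Qed.

Definition prod_weights : weights R {ffun 'I_n -> S} :=
  Weights prod_wt_gt0 prod_wt_sum1.

End ProductWeights.

Section PureNoise.
Context {R : realType} {d : measure_display} {T : measurableType d}.
Context (P : probability T R) (F : R -> set (set T)).
Context {p q : nat} (W : 'I_q -> R -> T -> R).
Context {S : finType} (s0 : S) (u : weights R S) (a : 'I_p -> S -> R) (n : nat).

Definition noise_covariance : 'M[R]_p := \matrix_(i, j) \sum_s u s * (a i s * a j s).

Definition quiet : {ffun 'I_n.+1 -> S} := [ffun=> s0].

(** Prices stand still and all assets are observed at the times k/n, so that
    the observations are the noise alone. The same coordinate drives the
    noise of all assets at one time, which makes these noises correlated. *)
Definition pure_noise_model : model R p q := {|
  disp := d;
  Om := finext T quiet;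
  Pr := finext_prob P (prod_weights u n.+1);
  filt := finext_filt P F;
  Defs.W := fun l t w => W l t w.1;
  X0 := fun _ _ => 0;
  mu := fun _ _ _ => 0;
  sigma := fun _ _ => 0;
  mart := fun _ _ _ => 0;
  levy := fun _ => mzero;
  N := fun _ _ => mzero;
  J2 := fun _ _ _ => 0;
  tau := fun k _ => k%:R / n%:R;
  nobs := fun _ => n;
  tobs := fun _ k _ => k%:R / n%:R;
  sel := fun _ k _ => k;
  eps := fun i k w => a i (w.2 (inord k));
  Defs.eta := noise_covariance |}.

Local Notation m := pure_noise_model.

Lemma mzero_jump_intensity B : jump_intensity (@mzero _ _ R) B = 0%E.
Proof. by rewrite /jump_intensity /product_measure1 /= integral_measure_zero. Qed.

Lemma cvg_prob0_eq0 (U : Type) (L : set_system U) (FL : Filter L)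
    d' (T' : measurableType d') (P' : probability T' R) (Z : U -> T' -> \bar R) :
  (forall x w, Z x w = 0%E) -> cvg_prob0 P' L Z.
Proof.
move=> Z0 e e0; rewrite [X in X @ _](_ : _ = fun=> 0%E); first exact: cvg_cst.
apply/funext => x; rewrite [X in P' X](_ : _ = set0) ?measure0//.
by apply/seteqP; split=> // w /=; rewrite Z0 lte_fin ltNge ltW.
Qed.

Lemma sigma_algebra_cst T' (G : set (set T')) (Q : Prop) :
  sigma_algebra setT G -> G [set _ | Q].
Proof.
move=> [G0 GC _]; have [q0|q0] := pselect Q.
  rewrite (_ : [set _ | _] = setT `\` set0); first exact: GC.
  by rewrite setD0; apply/seteqP; split.
by rewrite (_ : [set _ | _] = set0)//; apply/seteqP; split.
Qed.

Lemma usual_conditions_cst d' (T' : measurableType d') (P' : probability T' R)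
    (F' : R -> set (set T')) t (Q : Prop) :
  usual_conditions P' F' -> 0 <= t <= 1 -> F' t [set _ | Q].
Proof. by move=> [sF _ _ _] /sF[+ _]; exact: sigma_algebra_cst. Qed.

Lemma progressive_cst d' (T' : measurableType d') (P' : probability T' R)
   (F' : R -> set (set T')) (c : R) :
  usual_conditions P' F' -> progressive F' (fun _ _ => c).
Proof.
move=> uF' t B t01 mB; apply: sub_sigma_algebra.
exists [set` `[0, t]], [set _ | B c]; split=> //.
exact: usual_conditions_cst uF' t01.
Qed.

Lemma pure_noise_jump_diffusion :
  usual_conditions P F -> brownian P F W -> jump_diffusion m.
Proof.
move=> uF bW; have uF' := finext_usual_conditions (x0 := quiet) (prod_weights u n.+1) uF.
split.
- split; first exact: uF'.
  exact: finext_brownian.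
- by move=> i B mB; apply: (usual_conditions_cst (B 0) uF'); rewrite lexx ler01.
- move=> i; split; first exact: (progressive_cst 0 uF').
  by apply: aeW => w; exact: integrable0.
- move=> i; split=> [l|].
    rewrite [X in progressive _ X](_ : _ = fun _ _ => 0).
      exact: (progressive_cst 0 uF').
    by apply/funext => t; apply/funext => w; rewrite mxE.
  split.
  + by move=> t B t01 mB; exact: (usual_conditions_cst (B 0) uF' t01).
  + by apply: aeW => w; exact: continuous_subspaceT (@cst_continuous _ _ _).
  exists (fun _ => SimpleIntegrand 0 (fun _ => 0) (fun _ _ _ => 0)); split=> //.
  + by move=> k; split=> //; exists 0 => l k' w; rewrite normr0.
  + apply: cvg_prob0_eq0 => k w; apply: integral0_eq => s _.
    rewrite big1// => l _.
    by rewrite /simple_val /= big_ord0 mxE subr0 expr0n.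
  + move=> t t01; apply: cvg_prob0_eq0 => k w.
    by rewrite /simple_int big1 ?subr0 ?normr0// => l _; rewrite big_ord0.
- move=> i; split.
  + by split=> //; rewrite integral_measure_zero.
  + split.
    * by move=> t B C t01 mB Bt mC; exact: (usual_conditions_cst (C 0%E) uF' t01).
    * move=> B k mB B01 _; rewrite mzero_jump_intensity /= oppr0 expR0 mul1r.
      case: k => [|k].
        rewrite expr0 fact0 divr1 (_ : [set _ | _] = setT) ?probability_setT//.
        by apply/seteqP; split.
      rewrite expr0n/= mul0r (_ : [set _ | _] = set0) ?measure0//.
      apply/seteqP; split=> // w /= [] /eqP.
      by rewrite eq_sym pnatr_eq0.
    * by move=> B mB _; rewrite mzero_jump_intensity.
    * move=> s A k B C s01 FA mB tB mC.
      have [C0|/existsNP[j Cj]] := pselect (forall j, C j 0%E).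
        rewrite big1 ?mule1; last first.
          move=> j _; rewrite (_ : [set _ | _] = setT) ?probability_setT//.
          by apply/seteqP; split=> // w _; exact: C0.
        by congr (Pr m _); apply/seteqP; split=> [w []|w Aw].
      rewrite (_ : [set _ | _ /\ _] = set0); last first.
        by apply/seteqP; split=> // w [_ /(_ j)].
      rewrite measure0 (bigD1 j)//= (_ : [set _ | _] = set0); last first.
        by apply/seteqP; split.
      by rewrite measure0 mul0e mule0.
  + split.
    * by move=> t B t01 mB; exact: (usual_conditions_cst (B 0) uF' t01).
    * apply: aeW => w; split=> t t01; [exact: cvg_cst|].
      exact: is_cvg_cst.
    * move=> t t01; apply: cvg_prob0_eq0 => e w.
      rewrite /truncated_small_jumps /Rintegral !integral_measure_zero/=.
      by rewrite mulr0 !subr0 normr0.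
Qed.

Lemma pure_noise_sampling_scheme : (0 < n)%N -> sampling_scheme m n.
Proof.
move=> n0; have n0' : 0 < n%:R :> R by rewrite ltr0n.
split.
- have mcst (c : \bar R) : measurable_fun setT (fun _ : Om m => c).
    exact: measurable_cst.
  move=> Z [[k _ ->]|[[i [k [_ ->]]]|[i [k [_ ->]]]]].
  + exact: (mcst (k%:R / n%:R)%:E).
  + exact: (mcst (k%:R / n%:R)%:E).
  + exact: (mcst (k%:R)%:E).
- move=> w; split; rewrite /= ?mul0r ?divff ?gt_eqF// => k kn.
  by rewrite ltr_pM2r ?invr_gt0// ltr_nat.
- move=> i w k kn /=; rewrite divr_ge0//= ler_pdivrMr// mul1r ler_nat.
  exact: kn.
- by move=> i w k kn /=; rewrite ltr_pM2r ?invr_gt0// ltr_nat.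
- move=> i w [//|k] kn; split; first exact: kn.
  by rewrite /tausel /= lexx andbT ltr_pM2r ?invr_gt0// ltr_nat.
Qed.

Lemma pure_noise_prob (E : 'I_n.+1 -> set S) :
  Pr m [set w : finext T quiet | forall k, E k (w.2 k)] =
  (\prod_k \sum_s u s * (s \in E k)%:R)%:E.
Proof.
rewrite /= (finext_prob_snd _ _ [set f : {ffun 'I_n.+1 -> S} | forall k, E k (f k)]).
congr EFin; rewrite -product_expectation; apply: eq_bigr => f _; congr *%R.
rewrite -natr_prod; congr (_%:R).
have [fE|nfE] := boolP (f \in _).
  by rewrite big1// => k _; rewrite inE in fE; rewrite mem_set.
rewrite notin_setE in nfE; have /existsNP[k fk] := nfE.
by rewrite (bigD1 k)//= memNset.
Qed.

Lemma pure_noise_prob1 k (E : set S) :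
  Pr m [set w : finext T quiet | E (w.2 k)] = (\sum_s u s * (s \in E)%:R)%:E.
Proof.
have := pure_noise_prob (fun k' => [set s | k' = k -> E s]).
rewrite (_ : [set w | _] = [set w : finext T quiet | E (w.2 k)]); last first.
  apply/seteqP; split=> w /=; first by move=> /(_ k erefl).
  by move=> Ewk k' ->.
move=> ->; congr EFin; rewrite (bigD1 k)//= [X in _ * X]big1 ?mulr1; last first.
  move=> k' kk'; rewrite -[RHS](wt_sum1 u); apply: eq_bigr => s _.
  by rewrite mem_set ?mulr1// => /= ek; rewrite ek eqxx in kk'.
apply: eq_bigr => s _; congr (_ * (nat_of_bool _)%:R).
by apply/idP/idP; rewrite !inE; [exact|move=> Es _].
Qed.

Lemma pure_noise_prob2 k k' (E E' : set S) : k != k' ->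
  Pr m [set w : finext T quiet | E (w.2 k) /\ E' (w.2 k')] =
  (Pr m [set w : finext T quiet | E (w.2 k)] *
   Pr m [set w : finext T quiet | E' (w.2 k')])%E.
Proof.
move=> kk'.
have := pure_noise_prob (fun l => [set s | (l = k -> E s) /\ (l = k' -> E' s)]).
rewrite (_ : [set w | _] =
    [set w : finext T quiet | E (w.2 k) /\ E' (w.2 k')]); last first.
  apply/seteqP; split=> w /=.
    by move=> wE; split; [have [+ _] := wE k|have [_] := wE k']; exact.
  by move=> [Ek Ek'] l; split=> ->.
move=> ->; rewrite !pure_noise_prob1 -EFinM; congr EFin.
rewrite (bigD1 k)//= (bigD1 k')/=; last by rewrite eq_sym.
rewrite mulrA [X in _ * X]big1 ?mulr1; last first.
  move=> l /andP[lk lk']; rewrite -[RHS](wt_sum1 u); apply: eq_bigr => s _.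
  rewrite mem_set ?mulr1//=.
  by split=> e; [rewrite e eqxx in lk|rewrite e eqxx in lk'].
congr *%R; apply: eq_bigr => s _; congr (_ * (nat_of_bool _)%:R);
    apply/idP/idP; rewrite !inE/=.
- by move=> [+ _]; exact.
- by move=> Es; split=> // e; rewrite e eqxx in kk'.
- by move=> [_]; exact.
- by move=> Es; split=> // e; rewrite e eqxx in kk'.
Qed.

Lemma pure_noise_integral (h : {ffun 'I_n.+1 -> S} -> R) :
  (\int[Pr m]_w (h w.2)%:E =
   (\sum_(f : {ffun 'I_n.+1 -> S}) (\prod_(k : 'I_n.+1) u (f k)) * h f)%:E)%E.
Proof. exact: finext_integral_snd. Qed.

Lemma pure_noise_integral1 k (h : S -> R) :
  (\int[Pr m]_w (h (w.2 k))%:E = (\sum_s u s * h s)%:E)%E.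
Proof.
rewrite (pure_noise_integral (fun f : {ffun 'I_n.+1 -> S} => h (f k))); congr EFin.
pose h' k' s := if k' == k then h s else 1.
transitivity (\sum_(f : {ffun 'I_n.+1 -> S})
    (\prod_(k : 'I_n.+1) u (f k)) * (\prod_(k : 'I_n.+1) h' k (f k))).
  apply: eq_bigr => f _; congr *%R; rewrite (bigD1 k)//= big1 ?mulr1.
    by rewrite /h' eqxx.
  by move=> k' kk'; rewrite /h' (negbTE kk').
rewrite product_expectation (bigD1 k)//= [X in _ * X]big1 ?mulr1.
  by apply: eq_bigr => s _; rewrite /h' eqxx.
move=> k' kk'; rewrite -[RHS](wt_sum1 u); apply: eq_bigr => s _.
by rewrite /h' (negbTE kk') mulr1.
Qed.

Lemma pure_noise_iid : (forall i, \sum_s u s * a i s = 0) -> iid_noise m.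
Proof.
move=> a0 i; split.
- move=> k kn; split.
    exact: (finext_integrable_snd _ _ (fun f : {ffun 'I_n.+1 -> S} => a i (f (inord k)))).
  by rewrite unlock (pure_noise_integral1 (inord k) (a i)) a0.
- move=> k B kn mB.
  by rewrite !(pure_noise_prob1 _ (a i @^-1` B)).
- move=> B mB.
  rewrite (_ : [set w | _] =
      [set w : finext T quiet | forall k : 'I_n.+1, (a i @^-1` B k) (w.2 k)]); last first.
    apply/seteqP; split=> w /=.
      by move=> wB k; have := wB k (ltn_ord k); rewrite /= inord_val.
    by move=> wB k kn; have := wB (inord k); rewrite /= inordK.
  transitivity (\prod_(k < n.+1) \sum_s u s * (s \in a i @^-1` B k)%:R)%:E.
    exact: (pure_noise_prob (fun k => a i @^-1` B k)).
  rewrite -prodEFin; apply: eq_bigr => k _.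
  have <- := pure_noise_prob1 k (a i @^-1` B k).
  by congr (Pr m _); apply/seteqP; split=> w /=; rewrite inord_val.
Qed.

Lemma sigma_algebra_trivial T' :
  sigma_algebra setT [set A : set T' | A = set0 \/ A = setT].
Proof.
split=> [|A|A tA]; first by left.
  by case=> ->; [right; rewrite setD0|left; rewrite setDv].
have [[i Ai]|nA] := pselect (exists i, A i = setT).
  by right; apply/seteqP; split=> // w _; exists i => //; rewrite Ai.
left; apply/seteqP; split=> // w [i _].
by case: (tA i) => Ai; [rewrite Ai|case: nA; exists i].
Qed.

(** The sampling is deterministic, so its sigma-algebra is trivial and all
    conditions relative to it become unconditional. *)
Lemma pure_noise_sampling_trivial A :
  sigma_gen (sampling_vars m n) A -> A = set0 \/ A = setT.
Proof.
move: A; apply: smallest_sub; first exact: sigma_algebra_trivial.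
move=> A [Z mZ [B mB ->]].
have cst_trivial (c : \bar R) :
    [set A : set (Om m) | A = set0 \/ A = setT] ((fun=> c) @^-1` B).
  exact: (sigma_algebra_cst (B c) (sigma_algebra_trivial (Om m))).
case: mZ => [[k _ ->]|[[i [k [_ ->]]]|[i [k [_ ->]]]]].
- exact: (cst_trivial (k%:R / n%:R)%:E).
- exact: (cst_trivial (k%:R / n%:R)%:E).
- exact: (cst_trivial (k%:R)%:E).
Qed.

Lemma pure_noise_sampling_condition C_tau :
  (0 < n)%N -> 1 <= C_tau -> sampling_condition n m C_tau.
Proof.
move=> n0 C1; split.
  move=> i A B /pure_noise_sampling_trivial[] -> _.
    by rewrite set0I measure0 mul0e.
  by rewrite setTI [X in (X * _)%E]probability_setT mul1e.
apply: aeW => w k kn /=; rewrite -mulrBl -natrB// subSnn.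
by rewrite ler_wpM2r ?invr_ge0.
Qed.

Lemma pure_noise_bounded nu_mu nu_gamma :
  0 <= nu_mu -> 0 <= nu_gamma -> bounded_coefficients m nu_mu nu_gamma.
Proof.
move=> mu0 ga0; split; apply: aeW => w i t _; first by rewrite normr0.
by rewrite /gam /= mulmx0 mxE.
Qed.

Lemma pure_noise_jump_condition nu_I alpha :
  0 <= nu_I -> jump_condition n m nu_I alpha.
Proof.
move=> nu0; have idx0 : blumenthal_getoor_index m = 0.
  rewrite /blumenthal_getoor_index; set I := [set x | _].
  have -> : I = [set` `[0, +oo[].
    apply/seteqP; split=> x /=; rewrite in_itv/= andbT; first by case.
    by move=> x0; split=> // i; rewrite integral_measure_zero.
  by rewrite inf_itv.
by rewrite /jump_condition idx0 lexx ltr0n; split=> // i; rewrite lee_fin.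
Qed.

Lemma pure_noise_Xc i t (w : Om m) : Xc m i t w = 0.
Proof. by rewrite /Xc /= /Rintegral integral0 !addr0. Qed.

Lemma pure_noise_J1 i t (w : Om m) : J1 m i t w = 0.
Proof. by rewrite /J1 /large_jumps /Rintegral /= integral_measure_zero. Qed.

(** The price variables are constants or values of W, hence measurable for the
    enlarged filtration at time 1, while the noise depends on the finite factor
    alone: this is the independence of finext_indep. *)
Lemma pure_noise_indep :
  usual_conditions P F -> brownian P F W ->
  indep_sigma (Pr m) (sigma_gen (\bigcup_i noise_vars m i))
                     (sigma_gen (price_vars m)).
Proof.
move=> uF bW.
have uF' := finext_usual_conditions (x0 := quiet) (prod_weights u n.+1) uF.
have t11 : (0 : R) <= 1 <= (1 : R) by rewrite ler01 lexx.
have [sF' monoF' _ _] := uF'.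
have priceF A : sigma_gen (price_vars m) A -> finext_filt P F 1 A.
  move: A; apply: smallest_sub; first by have [] := sF' 1 t11.
  move=> A [Z pZ [B mB ->]].
  have cstF (c : \bar R) : finext_filt P F 1 ((fun=> c) @^-1` B : set (Om m)).
    exact: (usual_conditions_cst (B c) uF').
  have zeroF (V : Om m -> R) : (forall w, V w = 0) ->
      finext_filt P F 1 ((EFin \o V) @^-1` B).
    by move=> V0; rewrite (_ : V = fun=> 0); [exact: cstF|exact/funext].
  case: pZ => [[i [t [t01]]]|[[l [i [t [t01]]]]|[i [B' [_ [_ ->]]]]]].
  + case=> [[] ->|->].
    * by apply: zeroF => w; rewrite /X /J pure_noise_Xc pure_noise_J1 /= !addr0.
    * by apply: zeroF => w; exact: pure_noise_Xc.
    * by apply: zeroF => w; exact: pure_noise_J1.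
    * exact: zeroF.
    * exact: zeroF.
  + case=> ->.
      have /andP[t0 t1] := t01.
      suff: finext_filt P F t (Defs.W m l t @^-1` (EFin @^-1` B)).
        exact: (monoF' t 1 t0 t1 (lexx 1)).
      have [aW _ _] := finext_brownian (x0 := quiet) (prod_weights u n.+1) uF bW.
      have [adW _] := aW l.
      apply: adW => //.
      by rewrite -[_ @^-1` _]setTI; exact: EFin_measurable.
    rewrite (_ : (fun w => _) = EFin \o (fun=> 0)); first exact: zeroF.
    by apply/funext => w; rewrite mxE.
  + exact: cstF.
have noiseE A : sigma_gen (\bigcup_i noise_vars m i) A ->
    exists E : set {ffun 'I_n.+1 -> S}, A = [set w | E w.2].
  move: A; apply: smallest_sub.
    split=> [|A [E ->]|A EA].
    - by exists set0.
    - by exists (~` E); rewrite setTD.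
    - have /choice[E AE] i : exists E : set {ffun 'I_n.+1 -> S},
        A i = [set w : Om m | E w.2] by exact: EA.
      exists (\bigcup_i E i); apply/seteqP; split=> w [i _].
        by rewrite AE => Ew; exists i.
      by move=> Ew; exists i => //; rewrite AE.
  move=> A [Z [i _ [k kn ->]] [B mB ->]].
  by exists [set f : {ffun 'I_n.+1 -> S} | B (a i (f (inord k)))%:E].
move=> A B /noiseE[E ->] /priceF FB.
by rewrite setIC muleC; exact: (finext_indep _ _ uF t11 FB).
Qed.

Lemma pure_noise_noise_condition :
  usual_conditions P F -> brownian P F W -> (0 < n)%N -> noise_condition n m.
Proof.
move=> uF bW n0; split; last exact: pure_noise_indep.
move=> i j k k' kn k'n; split=> A /pure_noise_sampling_trivial[] -> sub.
- by rewrite integral_set0 measure0 mule0.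
- have {sub} kk' : k = k'.
    have := sub point I; rewrite /= => /mulIf/eqP.
    by rewrite eqr_nat => h; apply/eqP/h; rewrite invr_eq0 pnatr_eq0 -lt0n.
  rewrite [X in (_ * X)%E]probability_setT mule1 mxE kk'.
  exact: (pure_noise_integral1 (inord k') (fun s => a i s * a j s)).
- by move=> B B' mB mB'; rewrite !set0I measure0 !mul0e.
- move=> B B' mB mB'; rewrite setTI [X in (X * _ * _)%E]probability_setT mul1e.
  have {sub} kk' : k != k'.
    by have /= := sub point I; apply: contra => /eqP ->.
  apply: (@pure_noise_prob2 (inord k) (inord k') (a i @^-1` B) (a j @^-1` B')).
  by apply: contra kk' => /eqP/(congr1 val); rewrite /= !inordK// => ->.
Qed.

End PureNoise.

(** * Error probability and moments for pure noise *)

Lemma wt_compl (R : realType) (S : finType) (p : weights R S) s0 :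
  \sum_(s | s != s0) p s = 1 - p s0.
Proof. by rewrite -[X in X - _](wt_sum1 p) [in RHS](bigD1 s0)//= addrAC subrr add0r. Qed.

Lemma wt_compl_ge0 (R : realType) (S : finType) (p : weights R S) s0 :
  0 <= 1 - p s0.
Proof. by rewrite -wt_compl sumr_ge0// => s _; exact/ltW/wt_gt0. Qed.

(** Only the coordinates in the range of io contribute; the others integrate
    to 1. *)
Lemma product_expectation_sub (R : realType) (S : finType) (p : weights R S)
    (n K : nat) (io : 'I_K -> 'I_n) (h : S -> R) : injective io ->
  \sum_(f : {ffun 'I_n -> S}) (\prod_(k : 'I_n) p (f k)) *
     (\prod_(l < K) h (f (io l))) = (\sum_s p s * h s) ^+ K.
Proof.
move=> ioI; pose I := [set io l | l in 'I_K]%SET.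
pose h' k s := if k \in I then h s else 1.
transitivity (\sum_(f : {ffun 'I_n -> S}) (\prod_(k : 'I_n) p (f k)) *
    (\prod_(k : 'I_n) h' k (f k))).
  apply: eq_bigr => f _; congr *%R.
  by rewrite /h' -big_mkcond/= big_imset//= => l l' _ _; exact: ioI.
rewrite product_expectation.
rewrite (eq_bigr (fun k => if k \in I then \sum_s p s * h s else 1)); last first.
  move=> k _; rewrite /h'; case: ifP => // _.
  by rewrite -[RHS](wt_sum1 p); apply: eq_bigr => s _; rewrite mulr1.
by rewrite -big_mkcond/= prodr_const card_imset// card_ord.
Qed.

Lemma summation_by_parts (R : comPzRingType) (G y : nat -> R) K :
  \sum_(l < K) G l * (y l.+1 - y l) =
  \sum_(l < K) (G l - G l.+1) * y l.+1 + G K * y K - G 0%N * y 0%N.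
Proof.
elim: K => [|K IH]; first by rewrite !big_ord0; ring.
by rewrite !big_ord_recr/= IH; ring.
Qed.

Lemma expR_half_bounds (R : realType) : 3 / 2 <= expR (1 / 2 : R) <= 2.
Proof.
apply/andP; split.
  by apply: le_trans (expR_ge1Dx (1 / 2)); lra.
rewrite -[1 / 2]opprK expRN -[leRHS]invrK lef_pV2 ?posrE ?expR_gt0 ?invr_gt0//.
by apply: le_trans (expR_ge1Dx (- (1 / 2))); lra.
Qed.

(** Moments of a count of rare events have to be of the order of the
    probability of a single event, so the bound must vanish at N = 0: whence
    the subtracted 1. It comes from z <= exp z at z = N / (4 alpha), and from
    exp (N / 2) <= 3 (exp (N / 2) - 1) when N >= 1. *)
Lemma power_le_expR (R : realType) (alpha : R) (N : nat) : 0 < alpha ->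
  (N%:R ^+ 2) `^ alpha <=
  3 * (4 * alpha) `^ (2 * alpha) * (expR (N%:R / 2) - 1).
Proof.
move=> al0; case: N => [|N].
  by rewrite expr0n/= powR0 ?gt_eqF// mul0r expR0 subrr mulr0.
set x : R := N.+1%:R.
have al4 : 0 < 4 * alpha by rewrite mulr_gt0.
have x1 : 1 <= x by rewrite ler1n.
have -> : (x ^+ 2) `^ alpha = (4 * alpha) `^ (2 * alpha) *
    (x / (4 * alpha)) `^ (2 * alpha).
  rewrite -powRM; [|exact: ltW|by rewrite divr_ge0 ?ltW// (lt_le_trans ltr01)].
  rewrite mulrCA divff ?gt_eqF// mulr1 powRrM -powR_mulrn// ler0n //.
have le1 : (x / (4 * alpha)) `^ (2 * alpha) <= expR (x / 2).
  have -> : x / 2 = (x / (4 * alpha)) * (2 * alpha).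
    by field; rewrite gt_eqF.
  rewrite expRM; apply: ge0_ler_powR; rewrite ?nnegrE ?expR_ge0//.
  - by rewrite mulr_ge0// ltW.
  - by rewrite divr_ge0 ?ltW// (lt_le_trans ltr01).
  - by apply: le_trans (expR_ge1Dx _); lra.
have le2 : expR (x / 2) <= 3 * (expR (x / 2) - 1).
  suff : 3 / 2 <= expR (x / 2) by lra.
  have /andP[h _] := expR_half_bounds R; apply: le_trans h _.
  by rewrite ler_expR; lra.
rewrite -mulrA mulrCA ler_wpM2l ?powR_ge0//.
exact: le_trans le2.
Qed.

Lemma expR_le_inv1B (R : realType) (x : R) : 0 <= x <= 1 / 2 ->
  expR x <= 1 + 2 * x.
Proof.
move=> /andP[x0 x12].
have h : expR x <= (1 - x)^-1.
  rewrite -[x in leLHS]opprK expRN lef_pV2 ?posrE ?expR_gt0//; last lra.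
  exact: expR_ge1Dx.
apply: le_trans h _; rewrite -[leLHS]mul1r ler_pdivrMr; last lra.
by nra.
Qed.

Section PureNoiseMoments.
Context {R : realType} {d : measure_display} {T : measurableType d}.
Context (P : probability T R) (F : R -> set (set T)).
Context {p q : nat} (W : 'I_q -> R -> T -> R).
Context {S : finType} (s0 : S) (u : weights R S) (a : 'I_p -> S -> R) (n : nat).
Context (g : R -> R) (K : nat).

Local Notation m := (pure_noise_model P F W s0 u a n).

Lemma pure_noise_Yc i k (w : Om m) : Yc m i k w = a i (w.2 (inord k)).
Proof. by rewrite /Yc pure_noise_Xc add0r. Qed.

Lemma pure_noise_Y i k (w : Om m) : Y m i k w = a i (w.2 (inord k)).
Proof. by rewrite /Y /X /J pure_noise_Xc pure_noise_J1 /= !add0r. Qed.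

Lemma pure_noise_target i j (w : Om m) :
  target g K n m i j w =
  n%:R / (phi g K * K%:R) * zeta g K * noise_covariance u a i j.
Proof.
rewrite /target /Gam /Rintegral.
rewrite (_ : (fun s => _) = fun=> 0%E); last first.
  by apply/funext => s; rewrite /gam /= mulmx0 mxE.
rewrite integral0 /= add0r /rho /=; congr (_ / _ * _ * _).
rewrite (eq_bigr (fun=> 1)) => [|k _]; last by rewrite /tausel /= eqxx.
by rewrite big_const_nat subSS subn0 iter_addr_0.
Qed.

Lemma pure_noise_Qvec0 i j (w : Om m) :
  (forall k, a i (w.2 k) = 0) -> Qvec g K n m i j w = [tuple 0 | k < n - K].
Proof.
move=> a0; apply: eq_from_tnth => k; rewrite !tnth_mktuple /Q.
rewrite /preavg big1 ?mulr0 ?mul0r// => l _.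
by rewrite !pure_noise_Y !a0 subrr mulr0.
Qed.

(** When all the noise is neutral, the estimator is fed the zero vector; its
    error is then bounded below on an event of probability u s0 ^ (n + 1). *)
Lemma pure_noise_error_prob (That : (n - K).-tuple R -> R) i j r :
  a i s0 = 0 ->
  r <= `|That [tuple 0 | k < n - K]
      - n%:R / (phi g K * K%:R) * zeta g K * noise_covariance u a i j| ->
  (((u s0) ^+ n.+1)%:E <=
     Pr m [set w | (r <= `|That (Qvec g K n m i j w) - target g K n m i j w|)%R])%E.
Proof.
move=> a0 hr.
apply: le_trans (finext_prob_ge _ _ (quiet s0 n) _).
rewrite (_ : fiber _ @^-1` _ = setT); last first.
  apply/seteqP; split=> // w _ /=.
  rewrite pure_noise_target pure_noise_Qvec0// => k.
  by rewrite /= ffunE a0.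
rewrite probability_setT mule1 lee_fin /=.
under eq_bigr do rewrite ffunE.
by rewrite prodr_const card_ord.
Qed.

(** The degenerate counterpart: with noise vanishing identically, the
    estimator always sees the zero vector and its target is 0. *)
Lemma pure_noise_error_prob1 (That : (n - K).-tuple R -> R) i j r :
  (forall l s, a l s = 0) -> r <= `|That [tuple 0 | k < n - K]| ->
  (1 <=
     Pr m [set w | (r <= `|That (Qvec g K n m i j w) - target g K n m i j w|)%R])%E.
Proof.
move=> a0 hr; rewrite (_ : [set w | _] = setT) ?probability_setT//.
apply/seteqP; split=> // w _ /=.
rewrite pure_noise_target pure_noise_Qvec0// mxE big1 ?mulr0 ?subr0// => s _.
by rewrite a0 mul0r mulr0.
Qed.

(** A binomial variable, whose square controls the size of Q. *)
Definition loud (f : {ffun 'I_n.+1 -> S}) k : nat :=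
  \sum_(l < K) (f (inord (k + l.+1)) != s0).

(** As g vanishes at 0 and 1, summation by parts expresses the pre-averaged
    increment through the observations themselves, with the increments of g,
    of size L / K, as weights. *)
Lemma pure_noise_preavg_le i (k : nat) (w : Om m) (M L : R) :
  (0 < K)%N -> g 0 = 0 -> g 1 = 0 -> 0 <= M ->
  (forall l, (l < K)%N -> `|g (l%:R / K%:R) - g (l.+1%:R / K%:R)| <= L / K%:R) ->
  (forall s, `|a i s| <= M * (s != s0)%:R) ->
  `|preavg g K m (Yc m i) k w| <= M * L / K%:R * (loud w.2 k)%:R.
Proof.
move=> K0 g0 g1 M0 gL aM; rewrite /preavg.
have := summation_by_parts (fun l => g (l%:R / K%:R)) (fun l => Yc m i (k + l) w) K.
rewrite divff ?pnatr_eq0 -?lt0n// mul0r g0 g1 !mul0r addr0 subr0.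
under eq_bigr do rewrite addnS.
move=> ->; apply: le_trans (ler_norm_sum _ _ _) _.
rewrite /loud natr_sum mulr_sumr; apply: ler_sum => l _.
rewrite normrM pure_noise_Yc addnS.
have := aM (w.2 (inord (k + l).+1)).
have := gL l (ltn_ord l).
move=> h1 h2; apply: le_trans (ler_pM _ _ h1 h2) _ => //.
by rewrite le_eqVlt; apply/orP; left; apply/eqP; ring.
Qed.

(** The exponential moment of a binomial variable; the constant in the exponent is 1
    because exp (1/2) - 1 <= 1. *)
Lemma loud_exp_moment k : (k <= n - K)%N -> (K <= n)%N ->
  \sum_(f : {ffun 'I_n.+1 -> S}) (\prod_(k' : 'I_n.+1) u (f k')) *
     expR ((loud f k)%:R / 2) <= expR (K%:R * (1 - u s0)).
Proof.
move=> kn Kn; pose io (l : 'I_K) : 'I_n.+1 := inord (k + l.+1).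
have io_lt (l : 'I_K) : (k + l.+1 < n.+1)%N.
  by rewrite ltnS (leq_trans (leq_add kn (ltn_ord l)))// subnK.
have ioI : injective io.
  move=> l l' /(congr1 val); rewrite /= !inordK// => /addnI[]; exact: val_inj.
pose h s := expR ((s != s0)%:R / 2 : R).
rewrite (eq_bigr (fun f : {ffun 'I_n.+1 -> S} => (\prod_(k' : 'I_n.+1) u (f k')) *
    \prod_(l < K) h (f (io l)))); last first.
  by move=> f _; congr *%R; rewrite /loud natr_sum mulr_suml expR_sum.
rewrite (product_expectation_sub u h ioI).
have us := wt_compl u s0; have u1 := wt_compl_ge0 u s0.
have -> : \sum_s u s * h s = 1 + (expR (1 / 2) - 1) * (1 - u s0).
  rewrite (bigD1 s0)//= {1}/h eqxx mul0r expR0 mulr1.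
  rewrite (eq_bigr (fun s => u s * expR (1 / 2))); last first.
    by move=> s ss0; rewrite /h ss0.
  by rewrite -mulr_suml us; ring.
have /andP[e1 e2] := expR_half_bounds R.
rewrite expRM_natl.
apply: lerXn2r; rewrite ?nnegrE ?expR_ge0//.
  by rewrite addr_ge0// mulr_ge0//; lra.
apply: le_trans (expR_ge1Dx (1 - u s0)).
by rewrite lerD2l ler_piMl//; lra.
Qed.

Lemma pure_noise_Qc_snd i k (w w' : Om m) : w.2 = w'.2 ->
  Qc g K n m i i k w = Qc g K n m i i k w'.
Proof.
move=> ww'; suff e : preavg g K m (Yc m i) k w = preavg g K m (Yc m i) k w'.
  by rewrite /Qc e.
by apply: eq_bigr => l _; rewrite !pure_noise_Yc ww'.
Qed.

(** Q is at most a constant times loud ^ 2, and the moment of loud of order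
    2 alpha is O(K (1 - u s0)), like the probability that loud is nonzero, by
    power_le_expR and loud_exp_moment. *)
Lemma pure_noise_moment i k (M L alpha C : R) :
  (0 < K)%N -> (K <= n)%N -> (k <= n - K)%N ->
  g 0 = 0 -> g 1 = 0 -> 0 < phi g K -> 0 <= M -> 0 <= L -> 0 < alpha ->
  (forall l, (l < K)%N -> `|g (l%:R / K%:R) - g (l.+1%:R / K%:R)| <= L / K%:R) ->
  (forall s, `|a i s| <= M * (s != s0)%:R) ->
  K%:R * (1 - u s0) <= 1 / 2 ->
  (n%:R / (phi g K * K%:R) * (M * L / K%:R) ^+ 2) `^ alpha *
   (6 * (4 * alpha) `^ (2 * alpha) * (K%:R * (1 - u s0))) <= C ->
  ('E_(Pr m)[fun w => (`|Qc g K n m i i k w| `^ alpha)%R] <= C%:E)%E.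
Proof.
move=> K0 Kn kn g0 g1 ph0 M0 L0 al0 gL aM Ku hC; rewrite unlock.
set B := n%:R / (phi g K * K%:R) * (M * L / K%:R) ^+ 2 in hC *.
have K0' : 0 < K%:R :> R by rewrite ltr0n.
have B0 : 0 <= B.
  by rewrite /B mulr_ge0 ?sqr_ge0// divr_ge0// mulr_ge0 ?ltW.
pose c := 3 * (4 * alpha) `^ (2 * alpha).
have c0 : 0 <= c by rewrite mulr_ge0 ?powR_ge0.
have Qc_le (w : Om m) : `|Qc g K n m i i k w| `^ alpha <=
    B `^ alpha * c * (expR ((loud w.2 k)%:R / 2) - 1).
  have QB : `|Qc g K n m i i k w| <= B * (loud w.2 k)%:R ^+ 2.
    rewrite /Qc -mulrA -expr2 normrM ger0_norm; last first.
      by rewrite divr_ge0// mulr_ge0 ?ltW.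
    rewrite /B -mulrA -exprMn ler_pM//.
    - by rewrite divr_ge0// mulr_ge0 ?ltW.
    - by rewrite ler_wpM2r ?ler_nat ?leq_subr// invr_ge0 mulr_ge0 ?ltW.
    - rewrite ger0_norm ?sqr_ge0// -[leLHS]real_normK ?num_real//.
      rewrite ler_sqr ?nnegrE//; first exact: pure_noise_preavg_le.
      by rewrite !mulr_ge0// invr_ge0 ltW.
  apply: le_trans (_ : (B * (loud w.2 k)%:R ^+ 2) `^ alpha <= _).
    by apply: (ge0_ler_powR (ltW al0)) => //; rewrite nnegrE// mulr_ge0 ?sqr_ge0.
  rewrite powRM ?sqr_ge0// -mulrA ler_wpM2l ?powR_ge0//.
  exact: power_le_expR.
pose hb (f : {ffun 'I_n.+1 -> S}) := B `^ alpha * c * (expR ((loud f k)%:R / 2) - 1).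
apply: (@le_trans _ _ (\int[Pr m]_w (hb w.2)%:E)%E).
  apply: ge0_le_integral => //.
  - pose hq (f : {ffun 'I_n.+1 -> S}) := `|Qc g K n m i i k (point, f)| `^ alpha.
    rewrite (_ : (fun w => _) = fun w : Om m => (hq w.2)%:E).
      exact: (measurable_int (Pr m) (finext_integrable_snd P (prod_weights u n.+1) hq)).
    by apply/funext => w; rewrite /hq (pure_noise_Qc_snd _ _ (w' := w)).
  - exact: (measurable_int (Pr m) (finext_integrable_snd P (prod_weights u n.+1) hb)).
  - by move=> w _; rewrite lee_fin; exact: Qc_le.
rewrite pure_noise_integral lee_fin; apply: le_trans hC.
rewrite /hb; under eq_bigr => f _ do rewrite mulrCA mulrBr mulr1.
rewrite -mulr_sumr sumrB [X in _ - X](_ : _ = 1); last first.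
  exact: (wt_sum1 (prod_weights u n.+1)).
rewrite -mulrA ler_wpM2l ?powR_ge0//.
have := loud_exp_moment kn Kn.
have u1 := wt_compl_ge0 u s0.
set E := \sum_f _ => hE.
have h2 : expR (K%:R * (1 - u s0)) <= 1 + 2 * (K%:R * (1 - u s0)).
  by apply: expR_le_inv1B; rewrite mulr_ge0.
have -> : 6 * (4 * alpha) `^ (2 * alpha) * (K%:R * (1 - u s0)) =
    c * (2 * (K%:R * (1 - u s0))) by rewrite /c; ring.
by rewrite ler_wpM2l//; lra.
Qed.

End PureNoiseMoments.

(** * Increments of the weight function on the grid *)

Section WeightFunction.
Context {R : realType}.
Implicit Types g : R -> R.

(** A Lipschitz derivative on a bounded interval is bounded, and the mean value
    theorem applies up to the end points by continuity. *)
Lemma lipschitz_derive1_le g (a b : R) : a < b ->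
  {within `[a, b], continuous g} ->
  (forall x, a < x < b -> derivable g x 1) ->
  [lipschitz derive1 g x | x in `]a, b[] ->
  exists2 B, 0 <= B &
    forall x y, a <= x -> x <= y -> y <= b -> `|g y - g x| <= B * (y - x).
Proof.
move=> ab cg dg [M [_ /(_ (`|M| + 1))]].
rewrite (le_lt_trans (ler_norm M)) ?ltrDl// => /(_ isT) lip.
pose c := (a + b) / 2; pose L := `|M| + 1.
have L0 : 0 <= L by rewrite addr_ge0.
have acb : a < c < b by rewrite /c; apply/andP; split; lra.
exists (`|derive1 g c| + L * (b - a)); first by rewrite addr_ge0// mulr_ge0//; lra.
have derB z : a < z < b -> `|derive1 g z| <= `|derive1 g c| + L * (b - a).
  move=> azb; have /= := lip (z, c); rewrite !in_itv/= azb acb => /(_ (conj isT isT)) h.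
  have -> : derive1 g z = derive1 g c + (derive1 g z - derive1 g c) by ring.
  apply: le_trans (ler_normD _ _) _; rewrite lerD2l.
  apply: le_trans h _; rewrite ler_wpM2l// ler_norml; apply/andP.
  by move/andP: azb => [? ?]; move/andP: acb => [? ?]; split; lra.
move=> x y ax xy yb; move: xy; rewrite le_eqVlt => /orP[/eqP ->|xy].
  by rewrite !subrr normr0 mulr0.
have cxy : {within `[x, y], continuous g}.
  apply: continuous_subspaceW cg => z/=; rewrite !in_itv/=.
  by move=> /andP[? ?]; apply/andP; split; lra.
have dxy z : z \in `]x, y[ -> is_derive z 1 g (derive1 g z).
  rewrite in_itv/= => /andP[xz zy].
  rewrite derive1E; apply/derivableP/dg.
  by apply/andP; split; lra.
have [z + ->] := MVT xy dxy cxy; rewrite in_itv/= => /andP[xz zy].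
rewrite normrM (gtr0_norm (_ : 0 < y - x)); last lra.
rewrite ler_wpM2r//; first lra.
by apply: derB; apply/andP; split; lra.
Qed.

Lemma weight_function_lipschitz g : weight_function g ->
  exists2 L, 0 < L & forall x y, 0 <= x -> x <= y -> y <= 1 ->
    `|g y - g x| <= L * (y - x).
Proof.
move=> [cg _ _ _ [r [s [s0 sr piece]]]].
have s_le k l : (k <= l <= r)%N -> s k <= s l.
  move=> /andP[]; elim: l => [|l IH]; first by rewrite leqn0 => /eqP ->.
  rewrite leq_eqVlt => /predU1P[-> //|]; rewrite ltnS => kl lr.
  have [/ltW h _ _] := piece l lr.
  by apply: le_trans (IH kl (ltnW lr)) h.
suff [L L0 gL] : exists2 L, 0 <= L & forall x y, 0 <= x -> x <= y -> y <= s r ->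
    `|g y - g x| <= L * (y - x).
  exists (L + 1); first by rewrite ltr_wpDl.
  move=> x y x0 xy y1; apply: le_trans (gL x y x0 xy _) _; first by rewrite sr.
  by rewrite ler_wpM2r//; [lra|rewrite lerDl].
have : (r <= r)%N by [].
elim: {-2}r => [_|k IH kr].
  exists 0 => // x y x0 xy; rewrite s0 => y0.
  have -> : y = x by lra.
  by rewrite !subrr normr0 mulr0.
have [L L0 gL] := IH (ltnW kr).
have [skk dk lk] := piece k kr.
have sk0 : 0 <= s k by rewrite -s0; apply: s_le; exact: ltnW.
have sk1 : s k.+1 <= 1 by rewrite -sr; apply: s_le; rewrite kr leqnn.
have [|B B0 gB] := lipschitz_derive1_le skk _ dk lk.
  apply: continuous_subspaceW cg => z/=; rewrite !in_itv/=.
  by move=> /andP[? ?]; apply/andP; split; lra.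
exists (L + B); first exact: addr_ge0.
move=> x y x0 xy yk.
have [ysk|sky] := leP y (s k).
  apply: le_trans (gL x y x0 xy ysk) _.
  by rewrite ler_wpM2r// ?lerDl ?subr_ge0.
have [xsk|skx] := leP x (s k); last first.
  apply: le_trans (gB x y (ltW skx) xy yk) _.
  by rewrite ler_wpM2r// ?lerDr ?subr_ge0.
have h1 := gL x (s k) x0 xsk (lexx _).
have h2 := gB (s k) y (lexx _) (ltW sky) yk.
have -> : g y - g x = (g y - g (s k)) + (g (s k) - g x) by ring.
apply: le_trans (ler_normD _ _) _.
have : B * (y - s k) <= B * (y - x) by rewrite ler_wpM2l//; lra.
have : L * (s k - x) <= L * (y - x) by rewrite ler_wpM2l//; lra.
by lra.
Qed.

Lemma weight_function_neq0 g : weight_function g ->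
  exists2 x, 0 <= x <= 1 & g x != 0.
Proof.
move=> [_ _ _ + _]; apply: contraPP => g0; apply/negP; rewrite -leNgt.
rewrite /Rintegral integral0_eq// => x; rewrite /= in_itv/= => x01.
have [->|gx] := eqVneq (g x) 0; first by rewrite expr0n.
by exfalso; apply: g0; exists x.
Qed.

(** Cauchy-Schwarz against the constant 1, from the nonnegativity of the
    empirical variance. *)
Lemma sqr_sum_le (K : nat) (b : 'I_K -> R) :
  (\sum_l b l) ^+ 2 <= K%:R * \sum_l b l ^+ 2.
Proof.
case: K b => [|K] b; first by rewrite !big_ord0 expr0n mul0r.
have K0 : 0 < K.+1%:R :> R by rewrite ltr0n.
set A := \sum_l b l; set Q := \sum_l _.
have : 0 <= \sum_l (b l - A / K.+1%:R) ^+ 2 by apply: sumr_ge0 => l _; exact: sqr_ge0.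
under eq_bigr do rewrite sqrrB.
rewrite big_split/= sumrB -/Q.
rewrite (eq_bigr (fun l => 2 * (A / K.+1%:R) * b l)); last by move=> l _; ring.
rewrite -mulr_sumr -/A sumr_const card_ord -(mulr_natr _ K.+1).
set k : R := K.+1%:R in K0 *; rewrite (_ : _ - _ + _ = (k * Q - A ^+ 2) / k); last first.
  by field; rewrite gt_eqF.
by rewrite mul1r pmulr_lge0 ?invr_gt0 ?subr_ge0.
Qed.

(** The bound on the increments caps the moments of the pre-averages. The bound on zeta keeps the
    noise term of the target away from 0: g starts from 0 and reaches a
    fixed height at some grid point, so its K increments have a sum of squares
    of order at least 1 / K. *)
Lemma weight_function_grid g : weight_function g ->
  exists L h : R, exists K0 : nat, [/\ 0 < L, 0 < h &
    forall K, (0 < K)%N -> (K0 <= K)%N ->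
    [/\ 0 < phi g K, h ^+ 2 <= K%:R * zeta g K &
      forall l, (l < K)%N -> `|g (l%:R / K%:R) - g (l.+1%:R / K%:R)| <= L / K%:R]].
Proof.
move=> wg; have [L L0 gL] := weight_function_lipschitz wg.
have [x0 /andP[x00 x01] gx0] := weight_function_neq0 wg.
have [_ g0 g1 _ _] := wg.
have h0 : 0 < `|g x0| / 2 by rewrite divr_gt0// normr_gt0.
exists L, (`|g x0| / 2), (Num.truncn (L / (`|g x0| / 2))).+1; split=> // K K0 KL.
have K0' : 0 < K%:R :> R by rewrite ltr0n.
have LK : L / K%:R <= `|g x0| / 2.
  rewrite ler_pdivrMr// mulrC -ler_pdivrMr//.
  by apply: ltW; rewrite -truncn_lt_nat// divr_ge0 ?ltW.
have gK l : (l < K)%N -> `|g (l%:R / K%:R) - g (l.+1%:R / K%:R)| <= L / K%:R.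
  move=> lK; rewrite distrC.
  have := gL (l%:R / K%:R) (l.+1%:R / K%:R).
  rewrite -mulrBl -natrB// subSnn mul1r; apply.
  - by rewrite divr_ge0.
  - by rewrite ler_pM2r ?invr_gt0// ler_nat.
  - by rewrite ler_pdivrMr// mul1r ler_nat.
pose l := Num.truncn (x0 * K%:R).
have /andP[lx xl] : l%:R <= x0 * K%:R < l.+1%:R.
  by apply: truncn_itv; rewrite mulr_ge0.
have lKx : l%:R / K%:R <= x0 by rewrite ler_pdivrMr.
have xlK : x0 - l%:R / K%:R <= K%:R^-1.
  rewrite lerBlDl -[X in _ + X]mul1r -mulrDl natr1.
  by rewrite ler_pdivlMr// ltW.
have gl : `|g x0| / 2 <= `|g (l%:R / K%:R)|.
  have hl := gL (l%:R / K%:R) x0 (divr_ge0 (ler0n _ _) (ler0n _ _)) lKx x01.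
  have := ler_normD (g x0 - g (l%:R / K%:R)) (g (l%:R / K%:R)).
  rewrite subrK.
  have : L * (x0 - l%:R / K%:R) <= L / K%:R by rewrite ler_wpM2l// ltW.
  by lra.
have lltK : (l < K)%N.
  rewrite ltn_neqAle; apply/andP; split.
    apply/eqP => lK; move: gl; rewrite lK divff ?gt_eqF// g1 normr0.
    by lra.
  by rewrite -(ler_nat R) (le_trans lx)// ler_piMl.
split=> //.
- rewrite /phi pmulr_rgt0 ?invr_gt0// (bigD1 (Ordinal lltK))//=.
  rewrite ltr_wpDr//; first by apply: sumr_ge0 => k _; exact: sqr_ge0.
  by rewrite exprn_even_gt0//= -normr_gt0 (lt_le_trans h0).
- rewrite /zeta; pose b (k : 'I_K) := `|g (k%:R / K%:R) - g (k.+1%:R / K%:R)|.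
  rewrite (eq_bigr (fun k => b k ^+ 2)); last first.
    by move=> k _; rewrite /b real_normK ?num_real.
  apply: le_trans (sqr_sum_le b).
  have b0 : 0 <= \sum_k b k by apply: sumr_ge0 => k _; exact: normr_ge0.
  rewrite ler_sqr ?nnegrE ?(ltW h0)//.
  apply: le_trans gl _.
  have -> : \sum_k b k = \sum_(0 <= k < K) `|g (k%:R / K%:R) - g (k.+1%:R / K%:R)|.
    by rewrite big_mkord.
  rewrite (big_cat_nat (n := l))//=; last exact: ltnW.
  apply: le_trans (_ : \sum_(0 <= k < l)
      `|g (k%:R / K%:R) - g (k.+1%:R / K%:R)| <= _); last first.
    by rewrite lerDl sumr_ge0.
  apply: le_trans (ler_norm_sum _ _ _).
  rewrite -normrN -sumrN.
  under eq_bigr do rewrite opprB.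
  by rewrite telescope_sumr// mul0r g0 subr0.
Qed.

End WeightFunction.

(** * Rare signs as noise, and the two-point bound *)

Section SignNoise.
Context {R : realType}.

Definition sgn_val (s : option bool) : R :=
  if s is Some b then (-1) ^+ b else 0.

Section Weights.
Variables (e : R) (e0 : 0 < e) (e1 : e < 1).

(** Under these weights sgn_val is centred and has variance e. *)
Definition sign_wt (s : option bool) : R := if s is Some _ then e / 2 else 1 - e.

Lemma sum_option_bool (h : option bool -> R) :
  \sum_s h s = h None + h (Some true) + h (Some false).
Proof.
rewrite (bigD1 None)//= (bigD1 (Some true))//= (bigD1 (Some false))//=.
by rewrite big_pred0 ?addr0 ?addrA// => -[[]|].
Qed.

Let sign_wt_gt0 s : 0 < sign_wt s.
Proof. by case: s => [b|]/=; [rewrite divr_gt0|rewrite subr_gt0]. Qed.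

Let sign_wt_sum1 : \sum_s sign_wt s = 1.
Proof. by rewrite sum_option_bool /=; lra. Qed.

Definition sign_weights : weights R (option bool) := Weights sign_wt_gt0 sign_wt_sum1.

Lemma sign_noise_covariance p (M : 'I_p -> R) i j :
  noise_covariance sign_weights (fun l s => M l * sgn_val s) i j = M i * M j * e.
Proof. by rewrite mxE sum_option_bool /=; field. Qed.

Lemma sign_noise_centered (M : R) : \sum_s sign_weights s * (M * sgn_val s) = 0.
Proof. by rewrite sum_option_bool /=; ring. Qed.

Lemma sign_noise_le (M : R) s : 0 <= M ->
  `|M * sgn_val s| <= M * (s != None)%:R.
Proof.
move=> M0; case: s => [b|]/=; last by rewrite !mulr0 normr0.
by rewrite normrM normrX normrN1 expr1n ger0_norm.
Qed.

End Weights.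
End SignNoise.

Section SignModel.
Context {R : realType} {d : measure_display} {T : measurableType d}.
Context (P : probability T R) (F : R -> set (set T)).
Context {p q : nat} (W : 'I_q -> R -> T -> R).
Context (uF : usual_conditions P F) (bW : brownian P F W).
Context (e : R) (e0 : 0 < e) (e1 : e < 1) (n : nat) (n0 : (0 < n)%N).

Definition sign_model (M : 'I_p -> R) : model R p q :=
  pure_noise_model P F W None (sign_weights e0 e1) (fun l s => M l * sgn_val s) n.

Lemma sign_model_observed M : observed_jump_diffusion (sign_model M) n.
Proof.
split; [exact: pure_noise_jump_diffusion|exact: pure_noise_sampling_scheme|].
by apply: pure_noise_iid => i; exact: sign_noise_centered.
Qed.

Context (g : R -> R) (K : nat) (L : R).
Context (K0 : (0 < K)%N) (Kn : (K <= n)%N) (L0 : 0 <= L).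
Context (g0 : g 0 = 0) (g1 : g 1 = 0) (phi0 : 0 < phi g K).
Context (gL : forall l, (l < K)%N ->
  `|g (l%:R / K%:R) - g (l.+1%:R / K%:R)| <= L / K%:R).
Context (Ke : K%:R * e <= 1 / 2).

(** The hypothesis of pure_noise_moment for noise of amplitude M. *)
Definition moment_bound (M alpha C : R) :=
  (n%:R / (phi g K * K%:R) * (M * L / K%:R) ^+ 2) `^ alpha *
   (6 * (4 * alpha) `^ (2 * alpha) * (K%:R * e)) <= C.

Lemma sign_model_moments M alpha C :
  (forall i, 0 <= M i) -> (forall i, 0 < alpha i) ->
  (forall i, moment_bound (M i) (alpha i) C) ->
  Qc_moments g K n (sign_model M) C alpha.
Proof.
move=> M0 al0 MC i k /andP[k0 kn].
have e_wt : 1 - sign_weights e0 e1 None = e by rewrite /=; ring.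
apply: (@pure_noise_moment _ _ _ P F _ _ W _ None (sign_weights e0 e1)
  (fun l s => M l * sgn_val s) n g K i k (M i) L (alpha i) C) => //.
- by move=> s; exact: sign_noise_le.
- by rewrite e_wt.
- by rewrite e_wt; exact: MC.
Qed.

Lemma sign_model_assumptions M alpha nu_mu nu_gamma C_tau nu_Q nu_I :
  0 <= nu_mu -> 0 <= nu_gamma -> 1 <= C_tau -> 0 <= nu_I ->
  Qc_moments g K n (sign_model M) nu_Q alpha ->
  assumptions g K n (sign_model M) nu_mu nu_gamma C_tau nu_Q nu_I alpha.
Proof.
move=> mu0 ga0 tau1 nuI0 mom; split=> //.
- exact: pure_noise_bounded.
- exact: pure_noise_sampling_condition.
- exact: pure_noise_noise_condition.
- exact: pure_noise_jump_condition.
Qed.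

(** Amplitude 0 and amplitude M give the estimator the same zero vector, always
    in the first case and with probability at least (1 - e) ^ (n + 1) in the
    second, but the targets differ by at least 2 r. Its value at the zero vector
    is therefore off by r for one of the two. *)
Lemma two_point M alpha nu_mu nu_gamma C_tau nu_Q nu_I C_Xi i j (r delta : R)
    (That : (n - K).-tuple R -> R) :
  0 <= nu_mu -> 0 <= nu_gamma -> 1 <= C_tau -> 0 <= nu_Q -> 0 <= nu_I ->
  0 <= C_Xi ->
  (forall l, 0 <= M l) -> (forall l, 0 < alpha l) ->
  (forall l, moment_bound (M l) (alpha l) (Num.min nu_Q C_Xi)) ->
  2 * r <= n%:R / (phi g K * K%:R) * zeta g K * (M i * M j * e) ->
  delta <= (1 - e) ^+ n.+1 ->
  exists m : model R p q,
    [/\ observed_jump_diffusion m n,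
        assumptions g K n m nu_mu nu_gamma C_tau nu_Q nu_I alpha,
        Qc_moments g K n m C_Xi alpha
      & (delta%:E <= Pr m [set w |
          (r <= `|That (Qvec g K n m i j w) - target g K n m i j w|)%R])%E].
Proof.
move=> mu0 ga0 tau1 nuQ0 nuI0 Xi0 M0 al0 momM rM deltae.
have momC M' C : 0 <= C -> (forall l, 0 <= M' l) ->
    (forall l, moment_bound (M' l) (alpha l) C) ->
  Qc_moments g K n (sign_model M') C alpha.
  by move=> C0 M'0 MC; exact: sign_model_moments.
have mom0 C l : 0 <= C -> moment_bound 0 (alpha l) C.
  move=> C0; rewrite /moment_bound !mul0r expr0n/= mulr0.
  by rewrite powR0 ?mul0r// gt_eqF.
have momW C l : Num.min nu_Q C_Xi <= C -> moment_bound (M l) (alpha l) C.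
  exact: le_trans (momM l).
have [rT|Tr] := leP r `|That [tuple 0 | k < n - K]|.
(* The value at the zero vector is far from the target 0. *)
- exists (sign_model (fun=> 0)); split.
  + exact: sign_model_observed.
  + by apply: sign_model_assumptions => //; apply: momC => // l; exact: mom0.
  + by apply: momC => // l; exact: mom0.
  apply: (@le_trans _ _ 1%E).
    rewrite lee_fin (le_trans deltae)// exprn_ile1 ?subr_ge0 ?(ltW e1)//.
    by rewrite gerBl ltW.
  by apply: pure_noise_error_prob1 => // l s; rewrite mul0r.
(* The value at the zero vector is within r of 0, hence r away from rho. *)
exists (sign_model M); split.
- exact: sign_model_observed.
- apply: sign_model_assumptions => //; apply: momC => // l; apply: momW.
  by rewrite ge_min lexx.
- by apply: momC => // l; apply: momW; rewrite ge_min lexx orbT.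
apply: (@le_trans _ _ (((1 - e) ^+ n.+1)%:E)); first by rewrite lee_fin.
apply: pure_noise_error_prob; first by rewrite mulr0.
rewrite sign_noise_covariance.
set rho := _ * (M i * M j * e) in rM *; set t := That _ in Tr *.
rewrite distrC; have := ler_normD (rho - t) t; rewrite subrK.
have := ler_norm rho.
by lra.
Qed.

End SignModel.

Lemma ae_exists d (T : measurableType d) (R : realType) (P : probability T R)
    (E : T -> Prop) : {ae P, forall w, E w} -> exists w, E w.
Proof.
move=> nE; apply: contrapT => /forallNP nexE.
have : P setT = 0%E.
  apply: measure_negligible => //; apply: negligibleS nE => w _ /=; exact: nexE.
by rewrite probability_setT => /eqP; rewrite eqe oner_eq0.
Qed.

(** The n steps of a sampling scheme add up to 1. Hence if any model satisfies
    the mesh condition, so does the regular grid. *)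
Lemma mesh_constant_ge1 (R : realType) p q (m : model R p q) n (C_tau : R) :
  (0 < n)%N -> sampling_scheme m n -> sampling_condition n m C_tau -> 1 <= C_tau.
Proof.
move=> n0 [_ tau_ok _ _ _] [_ /ae_exists[w mesh]].
have [tau0 tau1 _] := tau_ok w.
have : \sum_(0 <= k < n) (tau m k.+1 w - tau m k w) <= \sum_(0 <= k < n) (C_tau / n%:R).
  rewrite !big_mkord; apply: ler_sum => k _; exact: mesh.
rewrite telescope_sumr// tau0 tau1 subr0 sumr_const_nat subn0.
by rewrite -(mulr_natr (C_tau / _)) divfK// pnatr_eq0 -lt0n.
Qed.

Lemma window_bounds (R : realType) (C_K : R) (K0 : nat) : 0 < C_K ->
  exists n0 : nat, forall n, (n0 <= n)%N ->
  [/\ (1 < n)%N, (0 < window C_K n)%N, (K0 <= window C_K n)%N,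
      (window C_K n <= n)%N &
      C_K / 2 * Num.sqrt n%:R <= (window C_K n)%:R <= C_K * Num.sqrt n%:R].
Proof.
move=> CK0.
(* This B makes C_K sqrt n >= 2 + K0, so that rounding down loses at
   most half, and C_K <= sqrt n, so that the window has at most n points. *)
pose B := C_K + (2 + K0%:R) / C_K + 2.
have B1 : 0 <= (2 + K0%:R) / C_K by rewrite divr_ge0 ?ltW// addr_ge0.
have B2 : 2 <= B by rewrite /B; lra.
exists (Num.truncn (B ^+ 2)).+1 => n; rewrite truncn_lt_nat ?sqr_ge0// => Bn.
have Bs : B <= Num.sqrt n%:R.
  rewrite -[B](@ger0_norm _ B); last lra.
  by rewrite -sqrtr_sqr ler_sqrt ?ler0n// ltW.
set s := Num.sqrt n%:R in Bs *.
have s0 : 0 <= s by exact: sqrtr_ge0.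
have sn : s * s = n%:R by rewrite -expr2 sqr_sqrtr.
have Cs0 : 0 <= C_K * s by rewrite mulr_ge0// ltW.
have /andP[wl wu] := truncn_itv Cs0; rewrite -/(window C_K n) in wl wu.
have hC : 2 + K0%:R <= C_K * s.
  rewrite mulrC -ler_pdivrMr//; apply: le_trans Bs; rewrite /B; lra.
have K0' : (0 : R) <= K0%:R by [].
have wl2 : C_K * s - 1 < (window C_K n)%:R by rewrite ltrBlDr natr1.
split.
- by rewrite -(ltr_nat R) -sn; nra.
- by rewrite -(ltr_nat R); lra.
- by rewrite -(ler_nat R); lra.
- rewrite -(ler_nat R) -sn; apply: le_trans wl _.
  rewrite ler_wpM2r//; apply: le_trans Bs; rewrite /B; lra.
- by rewrite wl andbT; lra.
Qed.

(** From 1 - e >= exp (- 2 e) for e <= 1/2, and n + 1 <= 2 n. *)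
Lemma quiet_probability (R : realType) (n : nat) (x : R) : (0 < n)%N ->
  0 <= x -> x / (4 * n%:R) <= 1 / 2 ->
  forall e, 0 <= e -> e <= x / (4 * n%:R) -> expR (- x) <= (1 - e) ^+ n.+1.
Proof.
move=> n0 x0 xn e e0 ex.
have n0' : 0 < n%:R :> R by rewrite ltr0n.
have e12 : e <= 1 / 2 by apply: le_trans xn.
have h : expR (- (2 * e)) <= 1 - e.
  rewrite expRN -[leLHS]mul1r ler_pdivrMr ?expR_gt0//.
  apply: le_trans (_ : (1 - e) * (1 + 2 * e) <= _); first by nra.
  by rewrite ler_wpM2l ?expR_ge1Dx//; lra.
apply: (@le_trans _ _ (expR (- (2 * e)) ^+ n.+1)); last first.
  by apply: lerXn2r; rewrite ?nnegrE ?expR_ge0//; lra.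
rewrite -expRM_natl ler_expR mulrN lerN2.
have : e * (4 * n%:R) <= x by rewrite -ler_pdivlMr// mulr_gt0.
have : (1 : R) <= n%:R by rewrite ler1n.
rewrite -natr1; nra.
Qed.

(** * Choice of the amplitudes and rate *)

Section Amplitude.
Context {R : realType}.
Implicit Types (g : R -> R) (x alpha kap L : R).

Definition amp_const kap alpha : R :=
  (kap / (6 * (4 * alpha) `^ (2 * alpha))) `^ (1 / (2 * alpha)).

(** The noise amplitude for which n / (phi K) * (M L / K) ^ 2, a bound
    on Q when a single noise variable is nonzero, equals 1. *)
Definition amp_scale g (n K : nat) L : R :=
  Num.sqrt (phi g K * K%:R / n%:R * (K%:R / L) ^+ 2).

(** Of the largest order that the moment of order alpha allows: a loud window
    has probability about x, so Q may be of order x ^ (- 1 / alpha) there,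
    and Q is quadratic in the amplitude. *)
Definition amplitude g (n K : nat) L kap x alpha : R :=
  amp_scale g n K L * (amp_const kap alpha * x `^ (- (1 / (2 * alpha)))).

Lemma amp_const_gt0 kap alpha : 0 < kap -> 0 < alpha -> 0 < amp_const kap alpha.
Proof.
move=> kap0 al0; rewrite powR_gt0// divr_gt0// mulr_gt0// powR_gt0//.
by rewrite mulr_gt0.
Qed.

Lemma amplitude_ge0 g n K L kap x alpha : 0 <= amplitude g n K L kap x alpha.
Proof. by rewrite !mulr_ge0 ?sqrtr_ge0 ?powR_ge0. Qed.

Lemma amp_scale_sqr g n K L : (0 < n)%N -> (0 < K)%N -> 0 < L -> 0 < phi g K ->
  n%:R / (phi g K * K%:R) * (L / K%:R) ^+ 2 * amp_scale g n K L ^+ 2 = 1.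
Proof.
move=> n0 K0 L0 ph0; rewrite sqr_sqrtr.
  by field; rewrite !gt_eqF ?ltr0n.
by rewrite mulr_ge0 ?sqr_ge0// divr_ge0// mulr_ge0// ltW.
Qed.

Lemma amplitude_moment_bound g n K L kap alpha e :
  (0 < n)%N -> (0 < K)%N -> 0 < L -> 0 < phi g K -> 0 < kap -> 0 < alpha ->
  0 < e ->
  moment_bound e n g K L (amplitude g n K L kap (K%:R * e) alpha) alpha kap.
Proof.
move=> n0 K0 L0 ph0 kap0 al0 e0; rewrite /moment_bound.
set A := 6 * _; set x := K%:R * e.
have A0 : 0 < A by rewrite /A mulr_gt0// powR_gt0// mulr_gt0.
have x0 : 0 < x by rewrite /x mulr_gt0// ltr0n.
have -> : n%:R / (phi g K * K%:R) * (amplitude g n K L kap x alpha * L / K%:R) ^+ 2 =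
    (amp_const kap alpha * x `^ (- (1 / (2 * alpha)))) ^+ 2.
  transitivity (n%:R / (phi g K * K%:R) * (L / K%:R) ^+ 2 * amp_scale g n K L ^+ 2 *
      (amp_const kap alpha * x `^ (- (1 / (2 * alpha)))) ^+ 2).
    by rewrite /amplitude; ring.
  by rewrite amp_scale_sqr// mul1r.
have -> : amp_const kap alpha * x `^ (- (1 / (2 * alpha))) =
    (kap / A / x) `^ (1 / (2 * alpha)).
  rewrite powRM ?invr_ge0 ?divr_ge0 ?ltW//.
  by rewrite /amp_const -/A -(powR_inv1 (ltW x0)) -powRrM mulN1r.
rewrite -powR_mulrn ?powR_ge0// -!powRrM.
rewrite [X in _ `^ X](_ : _ = 1); last by field; rewrite gt_eqF.
rewrite powRr1; last by rewrite !divr_ge0 ?ltW.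
have -> : kap / A / x * (A * x) = kap by field; rewrite !gt_eqF.
exact: lexx.
Qed.

(** The noise term of the target is a product of two amplitudes, each
    contributing half of its own exponent, times the variance e of the signs. *)
Lemma amplitude_bias g n K L h kap e alpha_i alpha_j :
  (0 < n)%N -> (0 < K)%N -> 0 < L -> 0 < phi g K -> 0 < kap ->
  0 < alpha_i -> 0 < alpha_j -> 0 < e -> h ^+ 2 <= K%:R * zeta g K ->
  (h / L) ^+ 2 * (amp_const kap alpha_i * amp_const kap alpha_j) *
    (K%:R * e) `^ (1 - 1 / (2 * alpha_i) - 1 / (2 * alpha_j)) <=
  n%:R / (phi g K * K%:R) * zeta g K *
   (amplitude g n K L kap (K%:R * e) alpha_i *
    amplitude g n K L kap (K%:R * e) alpha_j * e).
Proof.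
move=> n0 K0 L0 ph0 kap0 ai0 aj0 e0 hz; set x := K%:R * e; set theta := 1 - _ - _.
have K0' : 0 < K%:R :> R by rewrite ltr0n.
have x0 : 0 < x by rewrite /x mulr_gt0.
pose c := amp_const kap alpha_i * amp_const kap alpha_j.
have c0 : 0 <= c by rewrite mulr_ge0 ?powR_ge0.
have xtheta : x `^ theta =
    x * (x `^ (- (1 / (2 * alpha_i))) * x `^ (- (1 / (2 * alpha_j)))).
  have xI : x != 0 by rewrite gt_eqF.
  rewrite -powRD ?xI ?implybT// -{2}(powRr1 (ltW x0)) -powRD ?xI ?implybT//.
  by rewrite /theta; congr (_ `^ _); ring.
have -> : n%:R / (phi g K * K%:R) * zeta g K *
   (amplitude g n K L kap x alpha_i * amplitude g n K L kap x alpha_j * e) =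
   (K%:R * zeta g K) / L ^+ 2 * c * x `^ theta.
  rewrite xtheta; transitivity (n%:R / (phi g K * K%:R) * (L / K%:R) ^+ 2 *
      amp_scale g n K L ^+ 2 * (K%:R * zeta g K / L ^+ 2 * c *
        (x * (x `^ (- (1 / (2 * alpha_i))) * x `^ (- (1 / (2 * alpha_j))))))).
    rewrite /amplitude /c; set y := x `^ _; set z := x `^ _; rewrite /x.
    move: (n%:R / _) (amp_scale _ _ _ _) (amp_const _ _) (amp_const _ _) y z (zeta _ _).
    move=> D S bi bj y z Z; move: K%:R K0' => k k0.
    by field; rewrite !gt_eqF.
  by rewrite amp_scale_sqr// mul1r.
rewrite ler_wpM2r ?powR_ge0// ler_wpM2r// expr_div_n ler_wpM2r//.
by rewrite invr_ge0 sqr_ge0.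
Qed.

End Amplitude.

Theorem theorem2 (R : realType)
    (nu_mu nu_gamma C_tau nu_Q nu_I C_Xi C_K c alpha_i alpha_j : R)
    (g : R -> R)
    (hnu_mu : 0 < nu_mu) (hnu_gamma : 0 < nu_gamma) (hC_tau : 0 < C_tau)
    (hnu_Q : 0 < nu_Q) (hnu_I : 0 < nu_I) (hC_Xi : 0 < C_Xi) (hC_K : 0 < C_K)
    (hc : 0 < c) (hg : weight_function g)
    (halpha_i : 1 < alpha_i) (halpha_j : 1 < alpha_j)
    (alpha_ij := Num.min 2 (2 * alpha_i * alpha_j / (alpha_i + alpha_j)))
    (halpha_ij : 1 < alpha_ij < 2) :
  exists C : R, 0 < C /\ exists n0 : nat,
  forall (n p q : nat) (i j : 'I_p) (alpha : 'I_p -> R) (K := window C_K n),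
    (n0 <= n)%N -> (forall l, 1 < alpha l) ->
    alpha i = alpha_i -> alpha j = alpha_j ->
  forall m0 : model R p q,
    observed_jump_diffusion m0 n ->
    assumptions g K n m0 nu_mu nu_gamma C_tau nu_Q nu_I alpha ->
  forall delta : R,
    n%:R `^ c <= delta^-1 <= expR (n%:R `^ (1 / 2)) ->
  forall That : (n - K).-tuple R -> R -> R,
    (forall d, measurable_fun setT (That ^~ d)) ->
  exists m : model R p q,
    [/\ observed_jump_diffusion m n,
        assumptions g K n m nu_mu nu_gamma C_tau nu_Q nu_I alpha,
        Qc_moments g K n m C_Xi alpha
      & (delta%:E <=
         Pr m [set w | (C * (n%:R `^ (- (1 / 2)) * ln delta^-1)
                              `^ ((alpha_ij - 1) / alpha_ij) <=
                        `|That (Qvec g K n m i j w) delta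
                          - target g K n m i j w|)%R])%E].
Proof.
have [L [h [K0 [L0 h0 grid]]]] := weight_function_grid hg.
have [_ g0 g1 _ _] := hg.
have [n0 win] := window_bounds K0 hC_K.
have ai0 : 0 < alpha_i by lra.
have aj0 : 0 < alpha_j by lra.
pose kap := Num.min nu_Q C_Xi.
have kap0 : 0 < kap by rewrite lt_min hnu_Q hC_Xi.
pose theta := 1 - 1 / (2 * alpha_i) - 1 / (2 * alpha_j).
have thetaE : (alpha_ij - 1) / alpha_ij = theta.
  have : alpha_ij < 2 by case/andP: halpha_ij.
  rewrite /alpha_ij minEle; case: ifPn => [_|_ _]; first by rewrite ltxx.
  by rewrite /theta; field; rewrite !gt_eqF// ?mulr_gt0// addr_gt0.
have theta0 : 0 <= theta.
  rewrite -thetaE; case/andP: halpha_ij => a1 a2.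
  by rewrite divr_ge0//; lra.
(* The first bound on c1 yields the probability delta, the second K e <= 1/2. *)
pose c1 := Num.min (1 / 4) (1 / (4 * C_K)).
have c10 : 0 < c1 by rewrite lt_min divr_gt0//= divr_gt0// mulr_gt0.
have c14 : c1 <= 1 / 4 by rewrite ge_min lexx.
have c1K : C_K * c1 <= 1 / 4.
  have -> : 1 / 4 = C_K * (1 / (4 * C_K)) by field; rewrite gt_eqF.
  by rewrite ler_wpM2l ?ge_min ?lexx ?orbT// ltW.
pose c2 := C_K / 2 * c1.
have c20 : 0 < c2 by rewrite mulr_gt0// divr_gt0.
pose A := (h / L) ^+ 2 * (amp_const kap alpha_i * amp_const kap alpha_j).
have A0 : 0 < A.
  by rewrite mulr_gt0 ?exprn_gt0 ?divr_gt0// mulr_gt0// amp_const_gt0.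
exists (A * c2 `^ theta / 2); split.
  by rewrite divr_gt0// mulr_gt0// powR_gt0.
exists n0 => n p q i j alpha K nn0 alpha1 alphai alphaj m0 obs0 asm0 delta.
move=> /andP[deltal deltau] That _.
have [n1 K_gt0 K0K Kn /andP[Kl Ku]] := win n nn0.
have [ph0 hz gL] := grid K K_gt0 K0K.
have n_gt0 : (0 < n)%N by exact: ltn_trans n1.
have n0' : 0 < n%:R :> R by rewrite ltr0n.
have [[[uF bW] _ _ _ _] samp0 _] := obs0.
have [_ scond0 _ _ _] := asm0.
have tau1 := mesh_constant_ge1 n_gt0 samp0 scond0.
set s := Num.sqrt n%:R in Kl Ku.
have s1 : 1 <= s by rewrite -(sqrtr1 R) ler_sqrt// ler1n.
have ss : s * s = n%:R by rewrite -expr2 sqr_sqrtr.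
have n12 : n%:R `^ (1 / 2) = s by rewrite mul1r powR12_sqrt.
rewrite n12 in deltau; rewrite powRN n12 thetaE.
have deltaV0 : 0 < delta^-1 by apply: lt_le_trans deltal; rewrite powR_gt0.
have delta0 : 0 < delta by rewrite -invr_gt0.
pose lg := ln delta^-1.
have lg0 : 0 < lg.
  rewrite ln_gt0//; apply: lt_le_trans deltal.
  have : 1 `^ c < n%:R `^ c by apply: gt0_ltr_powR; rewrite ?nnegrE ?ltr1n.
  by rewrite powR1.
have lgs : lg <= s.
  by rewrite -(expRK s) ler_ln ?posrE ?expR_gt0.
pose e := c1 * lg / n%:R.
have e0 : 0 < e by rewrite divr_gt0// mulr_gt0.
have lgn : lg / n%:R <= 1 / s.
  rewrite -ss; rewrite ler_pdivrMr; last by rewrite mulr_gt0//; lra.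
  by rewrite mulrA divfK//; lra.
have sV1 : 1 / s <= 1 by rewrite ler_pdivrMr//; lra.
have e4 : e <= lg / (4 * n%:R).
  rewrite /e; have -> : lg / (4 * n%:R) = 1 / 4 * lg / n%:R.
    by field; rewrite gt_eqF.
  by rewrite ler_wpM2r ?invr_ge0// ler_wpM2r// ltW.
have lgn4 : lg / (4 * n%:R) <= 1 / 2.
  have -> : lg / (4 * n%:R) = lg / n%:R / 4 by field; rewrite gt_eqF.
  lra.
have e1 : e < 1 by lra.
have deltae : delta <= (1 - e) ^+ n.+1.
  apply: le_trans (quiet_probability n_gt0 (ltW lg0) lgn4 (ltW e0) e4).
  by rewrite expRN lnK ?posrE// invrK.
have eE : e = c1 * (lg / n%:R) by rewrite /e mulrA.
have Ke : K%:R * e <= 1 / 2.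
  have : K%:R * e <= C_K * s * e by rewrite ler_wpM2r// ltW.
  have : C_K * s * e <= C_K * c1.
    rewrite eE mulrACA -[leRHS]mulr1; rewrite ler_wpM2l//.
      by rewrite mulr_ge0 ?ltW.
    by rewrite mulrC -ler_pdivlMr//; lra.
  lra.
pose M l := amplitude g n K L kap (K%:R * e) (alpha l).
have al0 l : 0 < alpha l by have := alpha1 l; lra.
apply: (@two_point _ _ _ (Pr m0) (filt m0) _ _ (W m0) uF bW e e0 e1 n n_gt0
   g K L K_gt0 Kn (ltW L0) g0 g1 ph0 gL Ke M alpha
   nu_mu nu_gamma C_tau nu_Q nu_I C_Xi i j _ delta (That ^~ delta)) => //;
  try exact: ltW.
- by move=> l; exact: amplitude_ge0.
- by move=> l; exact: amplitude_moment_bound.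
rewrite /M alphai alphaj.
apply: le_trans (amplitude_bias n_gt0 K_gt0 L0 ph0 kap0 ai0 aj0 e0 hz).
rewrite -/theta -/A.
have -> : 2 * (A * c2 `^ theta / 2 * (s^-1 * ln delta^-1) `^ theta) =
    A * (c2 * (s^-1 * lg)) `^ theta.
  rewrite powRM ?mulr_ge0 ?invr_ge0 ?ltW//; last by lra.
  by rewrite /lg; field.
rewrite ler_wpM2l ?(ltW A0)// ge0_ler_powR ?nnegrE//.
- by rewrite !mulr_ge0 ?invr_ge0 ?ltW//; lra.
- by rewrite mulr_ge0// ltW.
apply: (@le_trans _ _ (C_K / 2 * s * e)); last by rewrite ler_wpM2r// ltW.
rewrite /c2 /e -ss le_eqVlt; apply/orP; left; apply/eqP; field.
by rewrite gt_eqF//; lra.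
Qed.
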